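(* $e^+$-\textsc{Clique} and $v^+$-\textsc{Clique} are not in PK unless $\mathrm{NP}\subseteq\mathrm{coNP}/\mathrm{poly}$.
   Context: \textsc{Clique}: given a graph $G$ and $k$, decide whether $G$ contains a clique of size $k$ (a maximization problem with parameter $k$). Local modifications: $G+e$ adds an edge between two non-adjacent vertices; $G+v$ adds a new vertex $v$ together with an arbitrary set of edges between $v$ and vertices of $G$. For $\mathrm{lm}\in\{e^+,v^+\}$, instances of $\mathrm{lm}$-\textsc{Clique} are $((G,k),s,(G_{\mathrm{lm}},k'))$ with $s$ a clique of size at least $k$ in $G$ if one exists and $s=\bot$ otherwise, $G_{\mathrm{lm}}$ the modified graph, and $k'\ge k$; yes-instances are those where $G_{\mathrm{lm}}$ has a clique of size $k'$. $\mathrm{lm}$-\textsc{Clique} is in PK if from such an instance one can compute in polynomial time an instance equivalent to $(G_{\mathrm{lm}},k')$ of size and parameter polynomial in the parameter. *)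

(* Defs.v *)
From mathcomp Require Import all_boot.

Set Implicit Arguments.
Unset Strict Implicit.
Unset Printing Implicit Defensive.

(* Every polynomial over nat is dominated by [poly_bound c] for some [c]. *)
Definition poly_bound (c n : nat) : nat := n ^ c + c.

(* [None] is the blank. *)
Definition symbol : finType := option bool.

Inductive move := MoveLeft | Stay | MoveRight.

(* [(l, r)] is a two-way infinite tape: the head scans the first symbol of [r],
   [l] lists the cells to the left of the head starting with the nearest one,
   and all the cells outside of both lists are blank. *)
Definition tape : Type := (seq symbol * seq symbol)%type.

Definition tape_read (t : tape) : symbol := head None t.2.

Definition tape_update (t : tape) (am : symbol * move) : tape :=
  let: (l, r) := t in
  let: (a, m) := am in
  match m with
  | MoveLeft => (behead l, head None l :: a :: behead r)
  | Stay => (l, a :: behead r)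
  | MoveRight => (a :: l, behead r)
  end.

(* There are [tm_work.+1] tapes; tape [ord0] is used for input and output. *)
Record TM := {
  tm_work : nat;
  tm_state : finType;
  tm_start : tm_state;
  tm_halt : pred tm_state;
  tm_delta : tm_state -> {ffun 'I_tm_work.+1 -> symbol} ->
             tm_state * {ffun 'I_tm_work.+1 -> symbol * move}
}.

Definition config (M : TM) : Type :=
  (tm_state M * {ffun 'I_(tm_work M).+1 -> tape})%type.

Definition tm_init (M : TM) (x : seq bool) : config M :=
  (tm_start M, [ffun i => if i == ord0 then ([::], map Some x) else ([::], [::])]).

Definition tm_step (M : TM) (c : config M) : config M :=
  let: (q, ts) := c in
  if tm_halt q then c else
  let: (q', acts) := tm_delta q [ffun i => tape_read (ts i)] in
  (q', [ffun i => tape_update (ts i) (acts i)]).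

Fixpoint read_bits (s : seq symbol) : seq bool :=
  if s is Some b :: s' then b :: read_bits s' else [::].

(* The output is read from the head of tape [ord0] up to the first blank. *)
Definition tm_output (M : TM) (c : config M) : seq bool :=
  read_bits (c.2 ord0).2.

(* Halting configurations are fixed by [tm_step], so [t] is an upper bound on
   the running time. *)
Definition computes_within (M : TM) (t : nat) (x y : seq bool) : Prop :=
  let c := iter t (@tm_step M) (tm_init M x) in
  tm_halt c.1 /\ tm_output c = y.

Definition language := seq bool -> Prop.

Definition language_class := language -> Prop.

(* Self-delimiting: every bit of [x] is preceded by a 1, and the first 0 in such
   a position marks the end of [x]. *)
Definition pair_enc (x y : seq bool) : seq bool :=
  flatten [seq [:: true; b] | b <- x] ++ false :: y.

Definition inP : language_class := fun L =>
  exists (M : TM) (c : nat), forall x, exists b : bool,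
    computes_within M (poly_bound c (size x)) x [:: b] /\ (L x <-> b).

Definition inNP : language_class := fun L =>
  exists (V : language) (c : nat), inP V /\
    forall x, L x <->
      exists w, size w <= poly_bound c (size x) /\ V (pair_enc x w).

Definition incoNP : language_class := fun L => inNP (fun x => ~ L x).

(* The class C/poly of Karp and Lipton. *)
Definition with_poly_advice (C : language_class) : language_class := fun L =>
  exists (L' : language) (a : nat -> seq bool) (c : nat),
    [/\ C L',
        forall n, size (a n) <= poly_bound c n &
        forall x, L x <-> L' (pair_enc x (a (size x)))].

Definition NP_sub_coNP_poly : Prop :=
  forall L, inNP L -> with_poly_advice incoNP L.

Record graph := Graph {
  order : nat;
  edge : rel 'I_order;
  edge_sym : symmetric edge;
  edge_irr : irreflexive edge
}.

Definition clique (G : graph) (S : {set 'I_(order G)}) : Prop :=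
  forall x y, x \in S -> y \in S -> x != y -> edge x y.

Definition has_clique (G : graph) (k : nat) : Prop :=
  exists S : {set 'I_(order G)}, clique S /\ #|S| = k.

Section AddEdge.
Variables (G : graph) (u v : 'I_(order G)).

Definition add_edge_rel : rel 'I_(order G) := fun x y =>
  edge x y || (x != y) && ([set x; y] == [set u; v]).

Lemma add_edge_sym : symmetric add_edge_rel.
Proof. by move=> x y; rewrite /add_edge_rel edge_sym eq_sym setUC. Qed.

Lemma add_edge_irr : irreflexive add_edge_rel.
Proof. by move=> x; rewrite /add_edge_rel edge_irr eqxx. Qed.

Definition add_edge : graph := Graph add_edge_sym add_edge_irr.
End AddEdge.

Section AddVertex.
Variables (G : graph) (A : {set 'I_(order G)}).

(* The new vertex is [ord_max]; the old vertices are the [lift ord_max i]. *)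
Definition add_vertex_rel : rel 'I_(order G).+1 := fun x y =>
  match unlift ord_max x, unlift ord_max y with
  | Some i, Some j => edge i j
  | Some i, None => i \in A
  | None, Some j => j \in A
  | None, None => false
  end.

Lemma add_vertex_sym : symmetric add_vertex_rel.
Proof.
move=> x y; rewrite /add_vertex_rel.
by case: unliftP => [i|] _; case: unliftP => [j|] _ //; rewrite edge_sym.
Qed.

Lemma add_vertex_irr : irreflexive add_vertex_rel.
Proof.
by move=> x; rewrite /add_vertex_rel; case: unliftP => [i|] _ //; rewrite edge_irr.
Qed.

Definition add_vertex : graph := Graph add_vertex_sym add_vertex_irr.
End AddVertex.

Inductive modification := EdgeAddition | VertexAddition.

Inductive modifies : modification -> graph -> graph -> Prop :=
| ModEdge (G : graph) (u v : 'I_(order G)) :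
    u != v -> ~~ edge u v -> modifies EdgeAddition G (add_edge u v)
| ModVertex (G : graph) (A : {set 'I_(order G)}) :
    modifies VertexAddition G (add_vertex A).

Record reopt_instance := {
  old_graph : graph;
  old_k : nat;
  old_sol : option {set 'I_(order old_graph)};  (* [None] stands for bot *)
  new_graph : graph;
  new_k : nat
}.

Definition valid_sol (G : graph) (k : nat) (s : option {set 'I_(order G)}) : Prop :=
  match s with
  | Some X => clique X /\ k <= #|X|
  | None => ~ exists S : {set 'I_(order G)}, clique S /\ k <= #|S|
  end.

Definition valid_instance (lm : modification) (I : reopt_instance) : Prop :=
  [/\ valid_sol (old_k I) (old_sol I),
      modifies lm (old_graph I) (new_graph I) &
      old_k I <= new_k I].

(* All the encodings below are self-delimiting (a vertex set being read relative
   to the order of its graph), so concatenation loses no information. Integers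
   are in unary: as usual in parameterized complexity, the size of an instance
   [(x, k)] is [|x| + k] up to a constant. *)
Definition enc_nat (n : nat) : seq bool := rcons (nseq n true) false.

(* The order, followed by the rows of the adjacency matrix. *)
Definition enc_graph (G : graph) : seq bool :=
  enc_nat (order G) ++
  [seq edge x y | x <- enum 'I_(order G), y <- enum 'I_(order G)].

Definition enc_sol (n : nat) (s : option {set 'I_n}) : seq bool :=
  if s is Some X then true :: [seq x \in X | x <- enum 'I_n] else [:: false].

Definition enc_clique (G : graph) (k : nat) : seq bool :=
  enc_graph G ++ enc_nat k.

Definition enc_instance (I : reopt_instance) : seq bool :=
  enc_clique (old_graph I) (old_k I) ++ enc_sol (old_sol I) ++
  enc_clique (new_graph I) (new_k I).

(* The parameter is [new_k], that of the Clique instance to be solved. The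
   machine is unconstrained on strings that do not encode a valid instance. *)
Definition lm_clique_in_PK (lm : modification) : Prop :=
  exists (M : TM) (c d : nat), forall I : reopt_instance, valid_instance lm I ->
    exists (H : graph) (h : nat),
      [/\ computes_within M (poly_bound c (size (enc_instance I)))
            (enc_instance I) (enc_clique H h),
          has_clique H h <-> has_clique (new_graph I) (new_k I),
          size (enc_clique H h) <= poly_bound d (new_k I) &
          h <= poly_bound d (new_k I)].

(* Main.v *)
From Stdlib Require Import FunctionalExtensionality ClassicalEpsilon.
From mathcomp Require Import all_boot zify.
Require Import Defs.

(* Since [old_k] may be 0, the empty set is a valid old solution, and it suffices
   to refute a polynomial kernel for Clique itself. By a Cook-Levin reduction to
   binary constraint satisfaction, the inputs of length n of a language L in NP
   correspond to cliques of size k(n) in a graph; adding t mutually non-adjacent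
   vertices, one per input, yields the OR of t inputs, with a parameter k(n) + 1
   independent of t. The kernel thus compresses t inputs to polynomially many bits
   in n. Following Fortnow and Santhanam, when t exceeds this number of bits there
   are an output y and a position p such that at least half of the inputs outside L
   occur at position p of a tuple outside L sent to y. Iterating, n + 1 pairs (p, y)
   cover all inputs outside L, and they are the advice. To certify that x is not in
   L, guess a pair (p, y) and a tuple whose entry p is x, and check that the kernel
   maps it to y. *)

Set Implicit Arguments.
Unset Strict Implicit.
Unset Printing Implicit Defensive.

(** * Polynomial bounds *)

(** The verifier has to be an actual Turing machine, so the proof leaves it as little to do as
    possible. It never carries out the Cook-Levin reduction: for a fixed input length, each bit of
    the encoded OR instance is either a constant or the comparison of one bit of one input with a
    constant. The advice can therefore store the instance as a list of addresses into a table of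
    such bits, and the machine only looks up addresses, runs the kernel and compares strings.
    Membership in P also asks for an answer within polynomial time on every string, malformed ones
    included; a clock takes care of this, and certificates are padded to pay for it.

    A clique only sees pairs of vertices, so the constraints on a computation must be binary,
    whereas the usual tableau relates several neighbouring cells. This is why tape positions are
    counted from the head and why cells carry extra information. *)

Lemma leq_poly_bound c m n : m <= n -> poly_bound c m <= poly_bound c n.
Proof. by move=> le_mn; case: c => // c; rewrite leq_add2r leq_exp2r. Qed.

Definition poly_bounded (f : nat -> nat) : Prop :=
  exists c, forall n, f n <= poly_bound c n.

(** A base of at least 2 absorbs constants into the exponent, so that sums and products are bounded
    by adding exponents. *)
Lemma poly_boundedP f :
  poly_bounded f <-> exists c, forall n, f n <= n.+2 ^ c.
Proof.
split=> -[c fP].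
  exists c.+1 => n; apply: leq_trans (fP n) _; rewrite /poly_bound expnS.
  have h1 : n ^ c <= n.+2 ^ c by case: c {fP} => // c; rewrite leq_exp2r //; lia.
  have h2 : c < n.+2 ^ c by apply: ltn_expl.
  nia.
(* The additive constant covers [n = 0] and [n = 1]; from 2 on, [n + 2] is at most the square of
   [n]. *)
exists (c.*2 + 3 ^ c) => n; apply: leq_trans (fP n) _; rewrite /poly_bound.
case: n => [|[|n]].
- have : 2 ^ c <= 3 ^ c by case: c {fP} => // c; rewrite leq_exp2r.
  lia.
- lia.
have h : n.+4 ^ c <= n.+2 ^ c.*2.
  rewrite -muln2 mulnC expnM; case: c {fP} => // c; rewrite leq_exp2r //.
  by rewrite !expnS expn0; lia.
apply: leq_trans h _; apply: leq_trans (leq_addr _ _).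
by rewrite leq_exp2l // leq_addr.
Qed.

Lemma poly_bounded_le f g :
  (forall n, f n <= g n) -> poly_bounded g -> poly_bounded f.
Proof. by move=> fg [c gP]; exists c => n; apply: leq_trans (fg n) (gP n). Qed.

Lemma poly_bounded_const k : poly_bounded (fun=> k).
Proof. by exists k => n; rewrite leq_addl. Qed.

Lemma poly_bounded_id : poly_bounded id.
Proof. by exists 1 => n; rewrite /poly_bound expn1 leq_addr. Qed.

Lemma poly_bounded_add f g :
  poly_bounded f -> poly_bounded g -> poly_bounded (fun n => f n + g n).
Proof.
move=> /poly_boundedP [c fP] /poly_boundedP [d gP]; apply/poly_boundedP.
exists (c + d).+1 => n; rewrite expnS expnD.
have := fP n; have := gP n.
have : 0 < n.+2 ^ c by rewrite expn_gt0.
have : 0 < n.+2 ^ d by rewrite expn_gt0.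
nia.
Qed.

Lemma poly_bounded_mul f g :
  poly_bounded f -> poly_bounded g -> poly_bounded (fun n => f n * g n).
Proof.
move=> /poly_boundedP [c fP] /poly_boundedP [d gP]; apply/poly_boundedP.
by exists (c + d) => n; rewrite expnD leq_mul.
Qed.

Lemma poly_bounded_comp c f :
  poly_bounded f -> poly_bounded (fun n => poly_bound c (f n)).
Proof.
move=> fP; apply: poly_bounded_add (poly_bounded_const _).
elim: c => [|c IHc]; first exact: poly_bounded_const 1.
apply: poly_bounded_le (poly_bounded_mul fP IHc) => n.
by rewrite expnS.
Qed.

Lemma poly_bounded_succ f : poly_bounded f -> poly_bounded (fun n => (f n).+1).
Proof. exact: poly_bounded_add (poly_bounded_const 1). Qed.

Lemma poly_bounded_double f : poly_bounded f -> poly_bounded (fun n => (f n).*2).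
Proof.
move=> fP; apply: poly_bounded_le (poly_bounded_add fP fP) => n.
by rewrite addnn.
Qed.

Ltac poly_bounded :=
  repeat first
    [ exact: poly_bounded_id | exact: poly_bounded_const | assumption
    | apply: poly_bounded_comp | apply: poly_bounded_add
    | apply: poly_bounded_mul | apply: poly_bounded_succ
    | apply: poly_bounded_double ].

(** * Tapes as pairs of streams, and structured machines *)

Definition stream := nat -> symbol.

Definition scons (a : symbol) (u : stream) : stream :=
  fun j => if j is j'.+1 then u j' else a.

Definition stl (u : stream) : stream := fun j => u j.+1.

Definition blank : stream := fun=> None.

Definition bits (s : seq bool) (u : stream) : stream :=
  foldr (fun b => scons (Some b)) u s.

Lemma scons_eta u : scons (u 0) (stl u) = u.
Proof. by apply: functional_extensionality => -[]. Qed.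

Lemma scons_blank : scons None blank = blank.
Proof. by apply: functional_extensionality => -[]. Qed.

Lemma bits_cat s1 s2 u : bits (s1 ++ s2) u = bits s1 (bits s2 u).
Proof. by rewrite /bits foldr_cat. Qed.

Lemma bits_rcons s b u : bits (rcons s b) u = bits s (scons (Some b) u).
Proof. by rewrite -cats1 bits_cat. Qed.

Lemma bitsE s j : bits s blank j = nth None (map Some s) j.
Proof. by elim: s j => [|b s IHs] [|j] //=; rewrite IHs. Qed.

(* Equality of [stape]s ignores trailing blanks, unlike equality of [tape]s. *)
Definition stape : Type := (stream * stream)%type.

Definition view (t : tape) : stape := (nth None t.1, nth None t.2).

Definition stape_read (t : stape) : symbol := t.2 0.

Definition stape_update (t : stape) (am : symbol * move) : stape :=
  match am.2 with
  | MoveLeft => (stl t.1, scons (t.1 0) (scons am.1 (stl t.2)))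
  | Stay => (t.1, scons am.1 (stl t.2))
  | MoveRight => (scons am.1 t.1, stl t.2)
  end.

Lemma view_read t : tape_read t = stape_read (view t).
Proof. by rewrite /stape_read /= nth0. Qed.

Lemma update_stay t : stape_update t (stape_read t, Stay) = t.
Proof. by rewrite /stape_update /stape_read /= scons_eta; case: t. Qed.

Lemma nth_scons a s : nth None (a :: s) = scons a (nth None s).
Proof. by apply: functional_extensionality => -[]. Qed.

Lemma nth_behead_stl s : nth None (behead s) = stl (nth None s).
Proof.
by apply: functional_extensionality => j; case: s => //=; rewrite nth_nil.
Qed.

Lemma view_update t am : view (tape_update t am) = stape_update (view t) am.
Proof.
by case: t am => l r [a []]; rewrite /view /stape_update /=
  !(nth_scons, nth_behead_stl) //= nth0.
Qed.

Lemma nth_nil_blank : nth None [::] = blank.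
Proof. by apply: functional_extensionality => j; rewrite nth_nil. Qed.

Lemma nth_bits s : nth None (map Some s) = bits s blank.
Proof. by apply: functional_extensionality => j; rewrite bitsE. Qed.

Lemma read_bits_view r b :
  nth None r 0 = Some b -> nth None r 1 = None -> read_bits r = [:: b].
Proof. by case: r => [//|s [|s' r]] /= -> //= ->. Qed.

(** Tapes are indexed by an arbitrary type, so that a routine is stated for the tapes it touches,
    whatever the others are. *)
Record mach (I : Type) := Mach {
  mstate : finType;
  mstart : mstate;
  mhalt : pred mstate;
  mdelta : mstate -> (I -> symbol) -> mstate * (I -> symbol * move)
}.

Section Machines.
Variable I : Type.
Implicit Types (P Q : mach I) (s : I -> stape) (b : (I -> symbol) -> bool).

Definition reads s : I -> symbol := fun i => stape_read (s i).

Definition updates s (f : I -> symbol * move) : I -> stape :=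
  fun i => stape_update (s i) (f i).

Definition mstep P (c : mstate P * (I -> stape)) : mstate P * (I -> stape) :=
  if mhalt c.1 then c else
  let d := mdelta c.1 (reads c.2) in (d.1, updates c.2 d.2).

Lemma iter_halted P c k : mhalt c.1 -> iter k (@mstep P) c = c.
Proof. by move=> hc; elim: k => //= k ->; rewrite /mstep hc. Qed.

Lemma iter_halted_le P c k1 k2 :
  k1 <= k2 -> mhalt (iter k1 (@mstep P) c).1 ->
  iter k2 (@mstep P) c = iter k1 (@mstep P) c.
Proof. by move=> /subnK <- hc; rewrite iterD iter_halted. Qed.

Definition runs P s n s' : Prop :=
  exists k q, [/\ k <= n, iter k (@mstep P) (mstart P, s) = (q, s') & mhalt q].

Lemma runs_le P s m n s' : runs P s m s' -> m <= n -> runs P s n s'.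
Proof.
by move=> [k [q [le_km e hq]]] le_mn; exists k, q; rewrite (leq_trans le_km).
Qed.

Definition stay (f : I -> symbol) : I -> symbol * move := fun i => (f i, Stay).

Lemma updates_stay s : updates s (stay (reads s)) = s.
Proof.
by apply: functional_extensionality => i; apply: update_stay.
Qed.

Definition act (f : (I -> symbol) -> I -> symbol * move) : mach I :=
  @Mach I bool false id (fun _ r => (true, f r)).

Lemma runs_act f s s' : updates s (f (reads s)) = s' -> runs (act f) s 1 s'.
Proof. by move=> <-; exists 1, true. Qed.

Definition seqm P Q : mach I :=
  @Mach I (mstate P + mstate Q)%type (inl (mstart P))
    (fun q => if q is inr q2 then mhalt q2 else false)
    (fun q r => match q with
     | inl q1 => if mhalt q1 then (inr (mstart Q), stay r) else
                 let d := mdelta q1 r in (inl d.1, d.2)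
     | inr q2 => let d := mdelta q2 r in (inr d.1, d.2)
     end).

(** A compound machine replays a component faithfully only until that component first halts, so
    every composition rule starts from the first halting time. *)
Lemma runs_first P s n s' : runs P s n s' ->
  exists k q, [/\ k <= n, iter k (@mstep P) (mstart P, s) = (q, s'), mhalt q &
    forall j, j < k -> ~~ mhalt (iter j (@mstep P) (mstart P, s)).1].
Proof.
move=> [k [q [le_kn e hq]]].
have ex : exists j, mhalt (iter j (@mstep P) (mstart P, s)).1.
  by exists k; rewrite e.
have [j hj jmin] := ex_minnP ex.
have le_jk : j <= k by apply: jmin; rewrite e.
exists j, q; split=> //; first exact: leq_trans le_jk le_kn.
  by rewrite -(iter_halted_le le_jk hj).
by move=> i lt_ij; apply: contraL lt_ij => hi; rewrite -leqNgt jmin.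
Qed.

Lemma iter_embed P Q (f : mstate P -> mstate Q) c k :
  (forall q r, ~~ mhalt q -> ~~ mhalt (f q) /\
     mdelta (f q) r = (f (mdelta q r).1, (mdelta q r).2)) ->
  (forall j, j < k -> ~~ mhalt (iter j (@mstep P) c).1) ->
  iter k (@mstep Q) (f c.1, c.2) =
    (f (iter k (@mstep P) c).1, (iter k (@mstep P) c).2).
Proof.
move=> fP; elim: k => //= k IHk hk.
rewrite IHk => [|j lt_jk]; last by apply: hk; apply: ltnW.
have hc := hk k (leqnn _); rewrite /mstep (negPf hc) /=.
by have [hf ->] := fP _ (reads (iter k (@mstep P) c).2) hc; rewrite (negPf hf).
Qed.

Lemma runs_seq P Q s n s1 m s2 :
  runs P s n s1 -> runs Q s1 m s2 -> runs (seqm P Q) s (n + m).+1 s2.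
Proof.
move=> /runs_first [k [q [le_kn e hq hk]]].
move=> /runs_first [l [q' [le_lm e' hq' hl]]].
exists (k + l.+1), (inr q'); split=> //; first by lia.
rewrite addnC iterD (@iter_embed P (seqm P Q) inl (mstart P, s)) //; last first.
  by move=> q0 r /= /negPf ->.
rewrite e -addn1 iterD /= {2}/mstep /= hq updates_stay.
rewrite (@iter_embed Q (seqm P Q) inr (mstart Q, s1)) ?e' //.
Qed.

Definition ifm b P Q : mach I :=
  @Mach I (option (mstate P + mstate Q)) None
    (fun q => match q with
     | Some (inl q1) => mhalt q1 | Some (inr q2) => mhalt q2 | None => false
     end)
    (fun q r => match q with
     | None => (Some (if b r then inl (mstart P) else inr (mstart Q)), stay r)
     | Some (inl q1) => let d := mdelta q1 r in (Some (inl d.1), d.2)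
     | Some (inr q2) => let d := mdelta q2 r in (Some (inr d.1), d.2)
     end).

Lemma runs_if b P Q s n s' :
  (if b (reads s) then runs P s n s' else runs Q s n s') ->
  runs (ifm b P Q) s n.+1 s'.
Proof.
case: ifP => eb /runs_first [k [q [le_kn e hq hk]]].
- exists k.+1, (Some (inl q)); split=> //.
  rewrite iterSr {2}/mstep /= eb updates_stay.
  by rewrite (@iter_embed P (ifm b P Q) (Some \o inl) (mstart P, s)) ?e.
- exists k.+1, (Some (inr q)); split=> //.
  rewrite iterSr {2}/mstep /= eb updates_stay.
  by rewrite (@iter_embed Q (ifm b P Q) (Some \o inr) (mstart Q, s)) ?e.
Qed.

(** State [None] is the exit, [Some None] the test, and [Some (Some q)] the body in state [q]. *)
Definition whilem b P : mach I :=
  @Mach I (option (option (mstate P))) (Some None) (fun q => q == None)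
    (fun q r => match q with
     | None => (None, stay r)
     | Some None => (if b r then Some (Some (mstart P)) else None, stay r)
     | Some (Some q1) => if mhalt q1 then (Some None, stay r) else
                         let d := mdelta q1 r in (Some (Some d.1), d.2)
     end).

Lemma runs_while_false b P s : ~~ b (reads s) -> runs (whilem b P) s 1 s.
Proof.
move=> eb; exists 1, None; split=> //.
by rewrite /= /mstep /= (negPf eb) updates_stay.
Qed.

Lemma runs_while_true b P s n s1 m s2 :
  b (reads s) -> runs P s n s1 -> runs (whilem b P) s1 m s2 ->
  runs (whilem b P) s (n + m).+2 s2.
Proof.
move=> eb /runs_first [k [q [le_kn e hq hk]]] [l [q' [le_lm e' hq']]].
exists (l + k.+2), q'; split=> //; first by lia.
rewrite iterD iterSr iterS [mstep (mstart _, s)]/mstep /= eb updates_stay.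
rewrite (@iter_embed P (whilem b P) (Some \o Some) (mstart P, s)) //; last first.
  by move=> q0 r /= /negPf ->.
by rewrite e /= {2}/mstep /= hq updates_stay.
Qed.

End Machines.

(** * Acting on a single tape: moving and rewinding *)

Section SingleTape.
Variable I : eqType.
Implicit Types (s : I -> stape) (i j : I).

Definition upd (A : Type) (s : I -> A) i (t : A) : I -> A :=
  fun j => if j == i then t else s j.

Lemma upd_id (A : Type) (s : I -> A) i : upd s i (s i) = s.
Proof.
by apply: functional_extensionality => j; rewrite /upd; case: eqP => [->|].
Qed.

Lemma upd_upd (A : Type) (s : I -> A) i t t' : upd (upd s i t) i t' = upd s i t'.
Proof. by apply: functional_extensionality => j; rewrite /upd; case: eqP. Qed.

Lemma upd_same (A : Type) (s : I -> A) i t : upd s i t i = t.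
Proof. by rewrite /upd eqxx. Qed.

Definition act1 i (g : (I -> symbol) -> symbol * move) : mach I :=
  act (fun r => upd (stay r) i (g r)).

Lemma runs_act1 i g s t :
  stape_update (s i) (g (reads s)) = t -> runs (act1 i g) s 1 (upd s i t).
Proof.
move=> <-; apply: runs_act; apply: functional_extensionality => j.
rewrite /updates /upd; case: eqP => [->//|_].
exact: update_stay.
Qed.

Definition left1 i : mach I := act1 i (fun r => (r i, MoveLeft)).
Definition right1 i : mach I := act1 i (fun r => (r i, MoveRight)).

Lemma runs_right1 i s u a r :
  s i = (u, scons a r) -> runs (right1 i) s 1 (upd s i (scons a u, r)).
Proof. by move=> si; apply: runs_act1; rewrite /reads si. Qed.

(** The left part of a tape after [l] has been written while moving right: the last bit written is
    the nearest to the head. *)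
Fixpoint rbits (l : seq bool) (u : stream) : stream :=
  if l is b :: l' then rbits l' (scons (Some b) u) else u.

Lemma rbits_rev l u : rbits l u = bits (rev l) u.
Proof. by elim: l u => //= b l IHl u; rewrite IHl rev_cons bits_rcons. Qed.

Lemma rbits_cat l1 l2 u : rbits (l1 ++ l2) u = rbits l2 (rbits l1 u).
Proof. by elim: l1 u => /=. Qed.

(** The first move is unconditional because the head starts just after the word, possibly on a
    blank, which would stop the loop at once. *)
Definition rewind_park i : mach I :=
  seqm (left1 i) (whilem (fun r => r i != None) (left1 i)).

Lemma runs_rewind_park i s l r : s i = (bits l blank, r) ->
  runs (rewind_park i) s (3 * size l).+3
    (upd s i (blank, scons None (rbits l r))).
Proof.
(* [t0 l r] is the tape after one move to the left: the head is on the last symbol written, or on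
   the blank before the word if [l] is empty. *)
move=> si; pose t0 l r := (stl (bits l blank), scons (bits l blank 0) r) : stape.
have left_t0 s' l' r' : s' i = (bits l' blank, r') ->
    runs (left1 i) s' 1 (upd s' i (t0 l' r')).
  move=> si'; apply: runs_act1.
  by rewrite si' /reads si' /stape_update /stape_read /= scons_eta.
have loop l' r' s' : s' i = t0 l' r' ->
    runs (whilem (fun r => r i != None) (left1 i)) s' (3 * size l').+1
      (upd s' i (blank, scons None (rbits l' r'))).
  elim: l' r' s' => [|b l' IHl'] r' s' si'.
    have -> : upd s' i (blank, scons None (rbits [::] r')) = s'.
      by rewrite -[RHS](upd_id _ i) si'.
    by apply: runs_while_false; rewrite /reads si'.
  rewrite /= -(upd_upd s' i (t0 l' (scons (Some b) r'))).
  apply: runs_le (runs_while_true _ (left_t0 s' l' (scons (Some b) r') _)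
    (IHl' (scons (Some b) r') _ _)) _.
  - by rewrite /reads si'.
  - by rewrite si'.
  - by rewrite upd_same.
  - lia.
rewrite -(upd_upd s i (t0 l r)).
apply: runs_le (runs_seq (left_t0 s l r si) (loop l r _ _)) _.
  by rewrite upd_same.
lia.
Qed.

Definition rewind i : mach I := seqm (rewind_park i) (right1 i).

Lemma runs_rewind i s l r : s i = (bits l blank, r) ->
  runs (rewind i) s (3 * size l + 5) (upd s i (blank, rbits l r)).
Proof.
move=> si; rewrite -(upd_upd s i (blank, scons None (rbits l r))).
rewrite -[(blank, rbits l r)]/(blank, _) -{2}scons_blank.
apply: runs_le (runs_seq (runs_rewind_park si) (runs_right1 _)) _.
  by rewrite upd_same.
lia.
Qed.

End SingleTape.

(** * From machines to Turing machines *)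

Definition init_tapes (I : Type) (z : seq bool) : option I -> stape :=
  fun i => if i is None then (blank, bits z blank) else (blank, blank).

Section ToTM.
Variables (I : finType) (P : mach (option I)).

Definition tape_of (i : 'I_#|I|.+1) : option I := omap enum_val (unlift ord0 i).

Definition index_of (j : option I) : 'I_#|I|.+1 :=
  if j is Some j' then lift ord0 (enum_rank j') else ord0.

Lemma index_ofK : cancel index_of tape_of.
Proof.
by case=> [j|]; rewrite /tape_of /index_of ?liftK ?unlift_none //= enum_rankK.
Qed.

Definition tm_of : TM :=
  @Build_TM #|I| (mstate P) (mstart P) (@mhalt _ P)
    (fun q r => let d := mdelta q (fun j => r (index_of j)) in
       (d.1, [ffun i => d.2 (tape_of i)])).

Lemma tm_of_iter z k (c := iter k (@tm_step tm_of) (tm_init tm_of z)) :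
  iter k (@mstep _ P) (mstart P, @init_tapes I z) =
    (c.1, fun j => view (c.2 (index_of j))).
Proof.
rewrite {}/c; elim: k => [|k IHk] /=.
  congr pair; apply: functional_extensionality => -[j|]; rewrite ffunE /=.
    by rewrite /view /= nth_nil_blank.
  by rewrite /view /= nth_bits nth_nil_blank.
rewrite IHk; move: (iter _ _ _) => [q ts] /=; rewrite /mstep /tm_step /=.
case: ifP => //= _.
have -> : (fun j => [ffun i => tape_read (ts i)] (index_of j)) =
    reads (fun j => view (ts (index_of j))).
  by apply: functional_extensionality => j; rewrite ffunE view_read.
congr pair; apply: functional_extensionality => j.
by rewrite !ffunE view_update index_ofK.
Qed.

Lemma tm_of_computes z n s b :
  runs P (@init_tapes I z) n s -> (s None).2 0 = Some b -> (s None).2 1 = None ->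
  computes_within tm_of n z [:: b].
Proof.
move=> [k [q [le_kn e hq]]] h0 h1.
have {e} : iter n (@mstep _ P) (mstart P, @init_tapes I z) = (q, s).
  by rewrite (iter_halted_le le_kn) e.
rewrite tm_of_iter /computes_within /= => -[-> es]; split=> //.
by apply: read_bits_view; move: h0 h1; rewrite -es.
Qed.

End ToTM.

Section OfTM.
Variables (M : TM) (I : Type) (slot : 'I_(tm_work M).+1 -> I).
Variable unslot : I -> option 'I_(tm_work M).+1.
Hypotheses (slotK : pcancel slot unslot) (unslotK : ocancel unslot slot).

(** This makes the kernel a subroutine of a larger machine: it runs on its own tapes while the
    others stand still. *)
Definition of_tm : mach I :=
  @Mach I (tm_state M) (tm_start M) (@tm_halt M)
    (fun q r => let d := tm_delta q [ffun i => r (slot i)] in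
       (d.1, fun j => if unslot j is Some i then d.2 i else (r j, Stay))).

Lemma runs_of_tm z k s (c := iter k (@tm_step M) (tm_init M z)) :
  tm_halt c.1 -> (forall i, s (slot i) = view ((tm_init M z).2 i)) ->
  runs of_tm s k (fun j => if unslot j is Some i then view (c.2 i) else s j).
Proof.
move=> hc s0; exists k, c.1; split=> //; rewrite {hc}/c.
elim: k => [|k IHk] /=.
  congr pair; apply: functional_extensionality => j.
  by have := unslotK j; case: unslot => //= i <-.
rewrite IHk; move: (iter _ _ _) => [q ts] /=; rewrite /mstep /tm_step /=.
case: ifP => //= _.
set r1 := [ffun i => _]; set r2 := [ffun i => _].
have -> : r1 = r2.
  by apply/ffunP => i; rewrite !ffunE /reads slotK view_read.
case: (tm_delta q r2) => q' d /=; congr pair.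
apply: functional_extensionality => j; rewrite /updates /reads.
by case: (unslot j) => [i|]; rewrite ?update_stay // ffunE view_update.
Qed.

End OfTM.

Lemma runs_to (I : Type) (P : mach I) s n s1 m s2 :
  runs P s n s1 -> s1 = s2 -> n <= m -> runs P s m s2.
Proof. by move=> h <-; apply: runs_le. Qed.

(** * Clocked machines *)

Section Clock.
Variables (I : finType) (P : mach (option I)).

Definition cvec (A : Type) (a c : A) (f : I -> A) : option (option I) -> A :=
  fun j => match j with
           | None => a | Some None => c | Some (Some j') => f j'
           end.

Lemma upd_cvec_inp A (a c t : A) f : upd (cvec a c f) None t = cvec t c f.
Proof. by apply: functional_extensionality => -[[]|]. Qed.

Lemma upd_cvec_clock A (a c t : A) f :
  upd (cvec a c f) (Some None) t = cvec a t f.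
Proof. by apply: functional_extensionality => -[[]|]. Qed.

Let inp : option (option I) := None.
Let clk : option (option I) := Some None.

Definition copy_clock : mach (option (option I)) :=
  whilem (fun r => r inp != None)
    (seqm (act1 clk (fun=> (Some true, MoveRight))) (right1 inp)).

Lemma runs_copy_clock z u v f :
  runs copy_clock (cvec (u, bits z blank) (v, blank) f) (5 * size z).+1
    (cvec (rbits z u, blank) (rbits (nseq (size z) true) v, blank) f).
Proof.
elim: z u v => [|b z IHz] u v; first exact: runs_while_false.
apply: runs_to (runs_while_true _ (runs_seq (runs_act1 erefl)
  (runs_right1 _)) _) erefl _; first by [].
- by rewrite upd_cvec_clock /=; reflexivity.
- by rewrite upd_cvec_clock upd_cvec_inp; apply: IHz.
- by rewrite /=; lia.
Qed.

(* Stops in the state [None] when the clock runs out. *)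
Definition clocked : mach (option (option I)) :=
  @Mach _ (option (mstate P)) (Some (mstart P))
    (fun q => if q is Some q' then mhalt q' else true)
    (fun q r => if q is Some q' then
       if r clk is None then (None, stay r) else
       let d := mdelta q' (fun j => r (omap Some j)) in
       (Some d.1, cvec (d.2 None) (r clk, MoveRight) (fun j => d.2 (Some j)))
     else (None, stay r)).

Definition with_clock (s : option I -> stape) (c : stape) :=
  cvec (s None) c (fun j => s (Some j)).

Lemma step_clocked q s u m : ~~ mhalt q ->
  @mstep _ clocked (Some q, with_clock s (u, bits (nseq m.+1 true) blank)) =
  let c := @mstep _ P (q, s) in
  (Some c.1, with_clock c.2 (scons (Some true) u, bits (nseq m true) blank)).
Proof.
move=> /negPf hq; rewrite /mstep /= hq.
have -> : (fun j => reads
    (with_clock s (u, scons (Some true) (bits (nseq m true) blank)))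
    (omap Some j)) = reads s.
  by apply: functional_extensionality => -[].
by congr pair; apply: functional_extensionality => -[[j|]|].
Qed.

(** The next machine does not see the final state, so acceptance must be legible on the tapes, as a
    clock that is not exhausted. Halting exactly when the clock runs out thus counts as a rejection,
    whence the strict [k < m]. *)
Lemma clockedP m q s u : exists k c q' s' u' m',
  [/\ k <= m.+1,
      iter k (@mstep _ clocked)
        (Some q, with_clock s (u, bits (nseq m true) blank)) =
        (q', with_clock s' (u', bits (nseq m' true) blank)),
      mhalt q' & c = (0 < m') && (reads s' None == Some true)] /\
  (c <-> exists k q' s', [/\ k < m, iter k (@mstep _ P) (q, s) = (q', s'),
     mhalt q' & reads s' None = Some true]).
Proof.
elim: m q s u => [|m IHm] q s u.
  case hq: (mhalt q).
    exists 0, false, (Some q), s, u, 0; split; first by split.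
    by split=> // -[k [q' [s' []]]].
  exists 1, false, None, s, u, 0; split; last first.
    by split=> // -[k [q' [s' []]]].
  by split=> //; rewrite /= /mstep /= hq /= updates_stay.
case hq: (mhalt q).
  exists 0, (reads s None == Some true), (Some q), s, u, m.+1.
  split; first by split.
  split=> [/eqP h|]; first by exists 0, q, s.
  move=> [k [q' [s' [_]]]]; rewrite iter_halted // => -[_ <-] _.
  by move=> ->.
have := IHm (@mstep _ P (q, s)).1 (@mstep _ P (q, s)).2 (scons (Some true) u).
move=> [k [c [q' [s' [u' [m' [[le_km e hq' ec] cP]]]]]]].
exists k.+1, c, q', s', u', m'; split.
  split=> //; rewrite iterSr step_clocked ?hq //.
rewrite cP; split=> -[l [q2 [s2 [le_l e2 hq2 r2]]]].
  exists l.+1, q2, s2; split=> //; rewrite iterSr -e2.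
  by case: (mstep _).
case: l le_l e2 => [|l] le_l; first by move=> [qq _]; rewrite -qq hq in hq2.
rewrite iterSr => e2; exists l, q2, s2; split=> //; rewrite -e2.
by case: (mstep _).
Qed.

(** The blank after the bit ends the output, since the rest of the tape may hold anything. *)
Definition answer (b : bool) : mach (option (option I)) :=
  seqm (act1 inp (fun=> (Some b, MoveRight))) (act1 inp (fun=> (None, MoveLeft))).

Lemma runs_answer b s : exists s',
  [/\ runs (answer b) s 3 s', (s' inp).2 0 = Some b & (s' inp).2 1 = None].
Proof.
set t1 := stape_update (s inp) (Some b, MoveRight).
set t2 := stape_update t1 (None, MoveLeft).
exists (upd (upd s inp t1) inp t2); split; try by rewrite upd_same.
apply: (@runs_seq _ _ _ _ 1 _ 1); first exact: runs_act1.
by apply: runs_act1; rewrite upd_same.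
Qed.

Definition clock_mach : mach (option (option I)) :=
  seqm copy_clock (seqm (rewind inp) (seqm (rewind clk) (seqm clocked
    (ifm (fun r => (r clk != None) && (r inp == Some true))
      (answer true) (answer false))))).

(* The clock is the input length, so slower machines need padded inputs. *)
Definition accepts (z : seq bool) : Prop :=
  exists k q s,
    [/\ k < size z, iter k (@mstep _ P) (mstart P, @init_tapes I z) = (q, s),
        mhalt q & reads s None = Some true].

(** The clock makes a total decider of any machine [P], so that [P] need only be analysed on the
    inputs of interest. *)
Lemma inP_accepts : inP accepts.
Proof.
(* Per input bit: 5 steps to copy it to the clock, 3 for each of the two rewinds, and 1 for the
   clocked run. *)
have [d dP] : poly_bounded (fun n => 12 * n + 30) by poly_bounded.
exists (tm_of clock_mach), d => z.
have [k [c [q [s [u [m [[le_k e hq ec] cP]]]]]]] :=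
  clockedP (size z) (mstart P) (@init_tapes I z) blank.
exists c; split; last by split=> /cP.
have [s' [run_s' h0 h1]] := runs_answer c
  (with_clock s (u, bits (nseq m true) blank)).
apply: (tm_of_computes _ h0 h1).
have -> : @init_tapes (option I) z = cvec (blank, bits z blank) (blank, blank)
    (fun=> (blank, blank)) by apply: functional_extensionality => -[[]|].
apply: runs_le (dP _).
apply: runs_to (runs_seq (runs_copy_clock _ _ _ _) (runs_seq
  (@runs_rewind _ inp _ (rev z) blank _) _)) erefl _.
  by rewrite /= rbits_rev.
  rewrite upd_cvec_inp rbits_rev revK.
  apply: runs_seq (@runs_rewind _ clk _ (nseq (size z) true) blank _) _.
    by rewrite /= rbits_rev rev_nseq.
  rewrite upd_cvec_clock rbits_rev rev_nseq.
  apply: runs_seq.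
    by exists k, q; split; [exact: le_k | exact: e | exact: hq].
  apply: runs_if.
  have -> : reads (with_clock s (u, bits (nseq m true) blank)) clk != None
      = (0 < m) by case: (m).
  rewrite /= -[reads _ inp]/(reads s None) -ec.
  by case: (c) run_s' => run_s'; exact: run_s'.
by rewrite size_rev size_nseq; lia.
Qed.

End Clock.

(** * The verifier *)

Definition bit_of (a : symbol) : bool := a == Some true.

(** Decoding as the machine does it on every string, since soundness is about arbitrary witnesses.
    After a lone final [true] the machine reads a blank, which [bit_of] takes for [false]. *)
Fixpoint undbl (w : seq bool) : seq bool :=
  match w with
  | true :: b :: w' => b :: undbl w'
  | [:: true] => [:: false]
  | _ => [::]
  end.

Fixpoint undbl_end (w : seq bool) : seq bool :=
  match w with
  | true :: b :: w' => undbl_end w'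
  | [:: true] => [::]
  | _ => w
  end.

Lemma undbl_pair_enc x y : undbl (pair_enc x y) = x.
Proof. by elim: x => //= b x ->. Qed.

Lemma undbl_end_pair_enc x y : undbl_end (pair_enc x y) = false :: y.
Proof. by elim: x. Qed.

Lemma size_pair_enc x y : size (pair_enc x y) = (2 * size x + size y).+1.
Proof. by elim: x => //= b x IHx; rewrite IHx; lia. Qed.

(** Each number gets one extra [true], so that a [false] in leading position can only mean the end
    of the list. *)
Definition unary_list (l : seq nat) : seq bool :=
  foldr (fun a s => nseq a.+1 true ++ false :: s) [:: false] l.

Lemma size_unary_list l : size (unary_list l) = (sumn l + 2 * size l).+1.
Proof. by elim: l => //= a l IHl; rewrite size_cat size_nseq /= IHl; lia. Qed.

(** * Tape routines: decoding, table look-up and comparison *)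

Section Routines.
Variable I : eqType.
Implicit Types (i j : I) (s : I -> stape).

Lemma upd_neq A (s : I -> A) i j t : j != i -> upd s i t j = s j.
Proof. by rewrite /upd => /negPf ->. Qed.

Lemma upd_swap A (s : I -> A) i j t t' : i != j ->
  upd (upd s i t) j t' = upd (upd s j t') i t.
Proof.
move=> neq_ij; apply: functional_extensionality => k; rewrite /upd.
by case: (k =P j) => // ->; rewrite eq_sym (negPf neq_ij).
Qed.

Ltac upd_eq :=
  let k := fresh "k" in
  apply: functional_extensionality => k; rewrite /upd;
  repeat case: eqP => ?; subst; try done;
  match goal with h : is_true (?x != ?x) |- _ => by rewrite eqxx in h end.

Ltac upd_at := repeat first [rewrite upd_same | rewrite upd_neq; [|by []]]; try done.

Definition undouble i j (wr : mach I) : mach I :=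
  seqm (whilem (fun r => r i == Some true)
    (seqm (right1 i) (seqm wr (right1 i)))) (right1 i).

Lemma right1_any i s u r :
  s i = (u, r) -> runs (right1 i) s 1 (upd s i (scons (r 0) u, stl r)).
Proof. by move=> si; apply: runs_right1; rewrite si scons_eta. Qed.

(** The writer is a parameter because the same loop serves to copy a word and to write each of its
    bits together with the complement. *)
Lemma runs_undouble i j wr (g : bool -> seq bool) s w u v :
  i != j ->
  (forall s v, s j = (v, blank) ->
     runs wr s 3 (upd s j (rbits (g (bit_of (reads s i))) v, blank))) ->
  s i = (u, bits w blank) -> s j = (v, blank) ->
  exists u', runs (undouble i j wr) s (9 * size (undbl w) + 3)
    (upd (upd s i (u', bits (behead (undbl_end w)) blank)) j
       (rbits (flatten [seq g b | b <- undbl w]) v, blank)).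
Proof.
move=> neq_ij wrP si sj; have neq_ji : j != i by rewrite eq_sym.
have body b r s' u1 v1 : s' i = (u1, scons (Some true) (scons b r)) ->
    s' j = (v1, blank) ->
    runs (seqm (right1 i) (seqm wr (right1 i))) s' 7
      (upd (upd s' i (scons b (scons (Some true) u1), r)) j
         (rbits (g (bit_of b)) v1, blank)).
  move=> si' sj'.
  apply: runs_to (runs_seq (runs_right1 si') (runs_seq (wrP _ v1 _)
    (runs_right1 (u := scons (Some true) u1) (a := b) (r := r) _))) _ _ => //.
  - by rewrite upd_neq.
  - by rewrite upd_neq // upd_same.
  - by rewrite /reads upd_same; upd_eq.
have loop n : forall w s u v, size w <= n ->
    s i = (u, bits w blank) -> s j = (v, blank) ->
    exists u', runs (whilem (fun r => r i == Some true)
        (seqm (right1 i) (seqm wr (right1 i)))) s (9 * size (undbl w) + 1)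
      (upd (upd s i (u', bits (undbl_end w) blank)) j
         (rbits (flatten [seq g b | b <- undbl w]) v, blank)).
  elim: n => [|n IHn] {}w {}s {}u {}v le_w {}si {}sj.
    case: w le_w si => // _ si; exists u; rewrite -si -sj /= upd_id upd_id.
    by apply: runs_while_false; rewrite /reads si.
  case: w le_w si => [|[] w] le_w si; first 1 last.
  - case: w le_w si => [|b w] le_w si.
      exists (scons None (scons (Some true) u)).
      apply: runs_to (runs_while_true _ (body None blank s u v _ sj)
        (runs_while_false _ _)) _ _; rewrite /reads /stape_read /= ?cats0 //.
      + by rewrite si.
      + by rewrite scons_blank.
      + by rewrite upd_neq // upd_same.
    have := IHn w (upd (upd s i (scons (Some b) (scons (Some true) u),
      bits w blank)) j (rbits (g b) v, blank))
      (scons (Some b) (scons (Some true) u)) (rbits (g b) v) _ _ _.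
    case=> [|||u' run_u'].
    + by apply: ltnW; move: le_w => /=; lia.
    + by rewrite upd_neq // upd_same.
    + by rewrite upd_same.
    exists u'; apply: runs_to (runs_while_true _ (body (Some b) (bits w blank)
      s u v si sj) _) erefl _; first by rewrite /reads si.
      have -> : bit_of (Some b) = b by case: (b).
      apply: runs_to run_u' _ (leqnn _); rewrite /= rbits_cat.
      by upd_eq.
    by rewrite /=; lia.
  - exists u; rewrite -si -sj /= upd_id upd_id.
    by apply: runs_while_false; rewrite /reads si.
  - exists u; rewrite -si -sj /= upd_id upd_id.
    by apply: runs_while_false; rewrite /reads si.
have [u' run_u'] := loop _ w s u v (leqnn _) si sj.
exists (scons (bits (undbl_end w) blank 0) u').
apply: runs_to (runs_seq run_u' (right1_any (u := u')
  (r := bits (undbl_end w) blank) _)) _ _.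
- by rewrite upd_neq // upd_same.
- rewrite upd_swap // upd_upd; congr (upd (upd _ _ (_, _)) _ _).
  by case: undbl_end.
- lia.
Qed.

Definition ones i : mach I := whilem (fun r => r i == Some true) (right1 i).

Lemma runs_ones i s a u r : s i = (u, bits (nseq a true) (scons (Some false) r)) ->
  runs (ones i) s (3 * a).+1
    (upd s i (rbits (nseq a true) u, scons (Some false) r)).
Proof.
elim: a s u => [|a IHa] s u si.
  by rewrite /= -si upd_id; apply: runs_while_false; rewrite /reads si.
apply: runs_to (runs_while_true _ (runs_right1 si)
  (IHa _ (scons (Some true) u) _)) _ _; rewrite ?upd_same ?upd_upd /reads ?si //.
lia.
Qed.

Definition skip_list i : mach I :=
  seqm (whilem (fun r => r i == Some true) (seqm (ones i) (right1 i))) (right1 i).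

Lemma runs_skip_list i s l u r : s i = (u, bits (unary_list l) r) ->
  exists u', runs (skip_list i) s (8 * size (unary_list l)) (upd s i (u', r)).
Proof.
have loop : forall s u, s i = (u, bits (unary_list l) r) -> exists u',
    runs (whilem (fun r => r i == Some true) (seqm (ones i) (right1 i))) s
      (8 * size (unary_list l) - 7) (upd s i (u', scons (Some false) r)).
  elim: l => [|a l IHl] {}s {}u si.
    exists u; rewrite -si upd_id.
    by apply: runs_while_false; rewrite /reads si.
  have si' : s i = (u, bits (nseq a.+1 true)
      (scons (Some false) (bits (unary_list l) r))) by rewrite si /= bits_cat.
  have [|u' run_u'] := IHl (upd s i (scons (Some false) (rbits (nseq a.+1 true) u),
    bits (unary_list l) r)) (scons (Some false) (rbits (nseq a.+1 true) u)).
    by rewrite upd_same.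
  exists u'; apply: runs_to (runs_while_true _ (runs_seq (runs_ones si')
    (runs_right1 _)) _) erefl _.
  - by rewrite /reads si.
  - by rewrite upd_same.
  - rewrite upd_upd; apply: runs_to run_u' _ (leqnn _); by rewrite upd_upd.
  - by rewrite !size_unary_list /=; lia.
move=> si; have [u' run_u'] := loop s u si.
exists (scons (Some false) u').
apply: runs_to (runs_seq run_u' (runs_right1 _)) (upd_upd _ _ _ _) _.
  by rewrite upd_same.
by rewrite size_unary_list; lia.
Qed.

(* The table tape is parked on the blank to the left of the table, so that
   [a.+1] moves to the right lead to the entry of address [a]. *)
Definition lookup_moves i j : mach I :=
  whilem (fun r => r i == Some true)
    (seqm (right1 i)
       (seqm (right1 j) (act1 j (fun r => (Some (bit_of (r j)), Stay))))).

Lemma nth_bit_of t : bit_of (bits t blank 0) = nth false t 0.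
Proof. by case: t => [|[]]. Qed.

Lemma nth_head_behead (t : seq bool) k :
  nth false (nth false t 0 :: behead t) k = nth false t k.
Proof. by case: t k => [|h t] [|k] //=; rewrite !nth_nil. Qed.

(** Every cell visited is overwritten by its bit, a blank becoming [false]. An address beyond the
    table thus reads [false] and leaves no gap at which [rewind_park] would stop too early; the
    price is that the table is preserved only up to trailing [false]s. *)
Lemma runs_lookup_moves i j s a u r v t : i != j ->
  s i = (u, bits (nseq a.+1 true) (scons (Some false) r)) ->
  s j = (v, scons None (bits t blank)) -> v = blank ->
  exists l h t' u', [/\ size l = a, h = nth false t a,
    forall k, nth false (rev l ++ h :: t') k = nth false t k &
    runs (lookup_moves i j) s (8 * a + 9)
      (upd (upd s i (u', scons (Some false) r)) j
         (bits l blank, scons (Some h) (bits t' blank)))].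
Proof.
move=> neq_ij si sj v0; have neq_ji : j != i by rewrite eq_sym.
have body s' u1 b r1 v1 c t1 : s' i = (u1, scons b r1) ->
    s' j = (v1, scons c (bits t1 blank)) ->
    runs (seqm (right1 i)
       (seqm (right1 j) (act1 j (fun r => (Some (bit_of (r j)), Stay))))) s' 5
      (upd (upd s' i (scons b u1, r1)) j
         (scons c v1, scons (Some (nth false t1 0)) (bits (behead t1) blank))).
  move=> si' sj'.
  apply: runs_to (runs_seq (runs_right1 si') (runs_seq (runs_right1
    (u := v1) (a := c) (r := bits t1 blank) _) (runs_act1 _))) _ _.
  - by rewrite upd_neq.
  - by rewrite /reads upd_same.
  - rewrite upd_upd; congr (upd _ _ (_, _)).
    by rewrite -nth_bit_of /stape_read /=; case: (t1).
  - by [].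
have loop : forall a s u l h t, s i = (u, bits (nseq a true) (scons (Some false) r)) ->
    s j = (bits l blank, scons (Some h) (bits t blank)) ->
    exists l' h' t' u', [/\ size l' = a + size l, h' = nth false (h :: t) a,
      forall k, nth false (rev l' ++ h' :: t') k = nth false (rev l ++ h :: t) k &
      runs (lookup_moves i j) s (8 * a + 1)
        (upd (upd s i (u', scons (Some false) r)) j
           (bits l' blank, scons (Some h') (bits t' blank)))].
  elim=> {s u t si sj} [|a' IHa] s u l h t si sj.
    exists l, h, t, u; split=> //; rewrite -sj -si !upd_id.
    by apply: runs_while_false; rewrite /reads si.
  set s1 := upd (upd s i (scons (Some true) u,
    bits (nseq a' true) (scons (Some false) r))) j
    (scons (Some h) (bits l blank),
     scons (Some (nth false t 0)) (bits (behead t) blank)).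
  have [||l' [h' [t' [u' [sz_l' eh' et' run']]]]] :=
    IHa s1 (scons (Some true) u) (h :: l) (nth false t 0) (behead t).
  - by rewrite /s1 upd_neq // upd_same.
  - by rewrite /s1 upd_same.
  exists l', h', t', u'; split.
  - by rewrite sz_l' /=; lia.
  - by rewrite eh' nth_head_behead.
  - move=> k; rewrite et' rev_cons cat_rcons !nth_cat; case: ifP => // _.
    by case: (_ - _) => //= k'; rewrite -[RHS]nth_head_behead.
  apply: runs_to (runs_while_true _ (body _ _ _ _ _ _ _ si sj) run') _ _.
  - by rewrite /reads si.
  - by rewrite /s1; upd_eq.
  - lia.
set s1 := upd (upd s i (scons (Some true) u,
    bits (nseq a true) (scons (Some false) r))) j
    (blank, scons (Some (nth false t 0)) (bits (behead t) blank)).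
have [||l' [h' [t' [u' [sz_l' eh' et' run']]]]] :=
    loop a s1 (scons (Some true) u) [::] (nth false t 0) (behead t).
- by rewrite /s1 upd_neq // upd_same.
- by rewrite /s1 upd_same.
exists l', h', t', u'; split.
- by rewrite sz_l' /= addn0.
- by rewrite eh' nth_head_behead.
- by move=> k; rewrite et' nth_head_behead.
apply: runs_to (runs_while_true _ (body _ _ _ _ _ _ _ si sj) _) _ _.
- by rewrite /reads si.
- by rewrite v0 scons_blank; apply: run'.
- by rewrite /s1; upd_eq.
- lia.
Qed.

Definition gather i j o : mach I :=
  seqm (whilem (fun r => r i == Some true)
    (seqm (lookup_moves i j)
      (seqm (act1 o (fun r => (Some (bit_of (r j)), MoveRight)))
        (seqm (right1 i) (rewind_park j))))) (right1 i).

(** Linear time because addresses are in unary: walking to an entry and back is paid for by the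
    length of its address. *)
Lemma runs_gather i j o s l u r t v : i != j -> i != o -> j != o ->
  s i = (u, bits (unary_list l) r) -> s j = (blank, scons None (bits t blank)) ->
  s o = (v, blank) ->
  exists u' tj, runs (gather i j o) s (30 * size (unary_list l))
    (upd (upd (upd s i (u', r)) j tj) o
       (rbits [seq nth false t a | a <- l] v, blank)).
Proof.
move=> neq_ij neq_io neq_jo si sj so.
have [neq_ji neq_oi neq_oj] : [/\ j != i, o != i & o != j].
  by split; rewrite eq_sym.
have loop : forall s u t v, s i = (u, bits (unary_list l) r) ->
    s j = (blank, scons None (bits t blank)) -> s o = (v, blank) ->
    exists u' tj, runs (whilem (fun r => r i == Some true)
      (seqm (lookup_moves i j)
        (seqm (act1 o (fun r => (Some (bit_of (r j)), MoveRight)))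
          (seqm (right1 i) (rewind_park j))))) s (30 * size (unary_list l) - 29)
    (upd (upd (upd s i (u', scons (Some false) r)) j tj) o
       (rbits [seq nth false t a | a <- l] v, blank)).
  elim: l {s u t v si sj so} => [|a l IHl] s u t v si sj so.
    exists u, (s j); rewrite /= -so -si !upd_id.
    by apply: runs_while_false; rewrite /reads si.
  have si' : s i = (u, bits (nseq a.+1 true)
      (scons (Some false) (bits (unary_list l) r))) by rewrite si /= bits_cat.
  have [l1 [h1 [t1 [u1 [sz_l1 eh1 et1 run1]]]]] :=
    runs_lookup_moves neq_ij si' sj erefl.
  set s1 := upd _ j _ in run1.
  have run2 : runs (act1 o (fun r => (Some (bit_of (r j)), MoveRight))) s1 1
      (upd s1 o (scons (Some (nth false t a)) v, blank)).
    apply: runs_act1; rewrite /s1 /reads upd_same -eh1 upd_neq // upd_neq // so.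
    by rewrite /stape_update /=; case: (h1).
  set s2 := upd s1 o _ in run2.
  have run3 : runs (right1 i) s2 1
      (upd s2 i (scons (Some false) u1, bits (unary_list l) r)).
    apply: runs_right1; rewrite /s2 /s1; upd_at.
  set s3 := upd s2 i _ in run3.
  have run4 : runs (rewind_park j) s3 (3 * size l1).+3
      (upd s3 j (blank, scons None (rbits l1 (scons (Some h1) (bits t1 blank))))).
    apply: runs_rewind_park; rewrite /s3 /s2 /s1; upd_at.
  set s4 := upd s3 j _ in run4.
  have [|||u' [tj run5]] := IHl s4 (scons (Some false) u1) (rev l1 ++ h1 :: t1)
      (scons (Some (nth false t a)) v).
  - rewrite /s4 /s3 /s2 /s1; upd_at.
  - by rewrite /s4 upd_same rbits_rev -[scons (Some h1) _]/(bits (h1 :: t1) _)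
      -bits_cat.
  - rewrite /s4 /s3 /s2 /s1; upd_at.
  exists u', tj.
  apply: runs_to (runs_while_true _ (runs_seq run1 (runs_seq run2
    (runs_seq run3 run4))) run5) _ _.
  - by rewrite /reads si.
  - by rewrite (eq_map et1) /s4 /s3 /s2 /s1; upd_eq.
  - by rewrite !size_unary_list /= sz_l1; lia.
have [u' [tj run']] := loop s u t v si sj so.
exists (scons (Some false) u'), tj.
apply: runs_to (runs_seq run' (runs_right1 (u := u') (a := Some false) (r := r) _)) _ _.
- upd_at.
- by upd_eq.
- by rewrite size_unary_list; lia.
Qed.

Definition check1 i (c : (I -> symbol) -> bool) : mach I :=
  act1 i (fun r => (Some (bit_of (r i) && c r), Stay)).

Lemma runs_check1 i c s b : reads s i = Some b -> exists t,
  [/\ runs (check1 i c) s 1 (upd s i t) &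
      stape_read t = Some (b && c (reads s))].
Proof.
move=> si; exists (stape_update (s i) (Some (b && c (reads s)), Stay)).
by split=> //; apply: runs_act1; rewrite si; case: b si.
Qed.

Definition compare i o f : mach I :=
  seqm (whilem (fun r => r i == Some true)
    (seqm (right1 i) (seqm
      (ifm (fun r => r i == Some true)
         (seqm (check1 f (fun r => r o == Some true)) (right1 i))
         (check1 f (fun r => r o == Some false)))
      (seqm (right1 i) (right1 o)))))
    (check1 f (fun r => r o == None)).

(** In the code of [y] a bit is [true true false] or [true false], so the second symbol tells which.
    Mismatches are recorded in the flag on tape [f] without leaving the loop; the final test for a
    blank rejects outputs that properly extend [y]. *)
Lemma runs_compare i o f s (y : seq bool) u r v e b :
  i != o -> i != f -> o != f ->
  s i = (u, bits (unary_list (map nat_of_bool y)) r) ->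
  s o = (v, nth None e) -> reads s f = Some b ->
  exists s', runs (compare i o f) s
      (20 * size (unary_list (map nat_of_bool y))) s' /\
    reads s' f = Some (b && (read_bits e == y)).
Proof.
move=> neq_io neq_if neq_of si so sf.
have [neq_oi neq_fi neq_fo] : [/\ o != i, f != i & f != o].
  by split; rewrite eq_sym.
have step : forall s b0 (y : seq bool) u v e b,
    s i = (u, bits (unary_list (map nat_of_bool (b0 :: y))) r) ->
    s o = (v, nth None e) -> reads s f = Some b ->
  exists s' u' v',
  [/\ runs (seqm (right1 i) (seqm
      (ifm (fun r => r i == Some true)
         (seqm (check1 f (fun r => r o == Some true)) (right1 i))
         (check1 f (fun r => r o == Some false)))
      (seqm (right1 i) (right1 o)))) s 10 s',
      s' i = (u', bits (unary_list (map nat_of_bool y)) r),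
      s' o = (v', nth None (behead e)) &
      reads s' f = Some (b && (head None e == Some b0))].
  move=> {si so sf u v e b y} s0 b0 y u v e b si so sf.
  set rest := bits (unary_list (map nat_of_bool y)) r.
  have run_end s1 u1 : s1 i = (u1, scons (Some false) rest) ->
      s1 o = (v, nth None e) ->
      runs (seqm (right1 i) (right1 o)) s1 3
       (upd (upd s1 i (scons (Some false) u1, rest)) o
         (scons (head None e) v, nth None (behead e))).
    move=> si1 so1; apply: runs_seq (runs_right1 si1) (runs_right1 _).
    rewrite upd_neq // so1 nth_behead_stl; congr pair.
    by rewrite -[LHS]scons_eta nth0.
  have eo s1 : s1 o = (v, nth None e) -> reads s1 o = head None e.
    by move=> so1; rewrite /reads so1 /stape_read /= nth0.
  have run1 := runs_right1 (s := s0) (i := i) (u := u) (a := Some true).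
  case: b0 si => si.
    have {}run1 := run1 (scons (Some true) (scons (Some false) rest)) si.
    set s1 := upd s0 i _ in run1.
    have [|t [run2 et]] := runs_check1 (i := f)
      (fun r => r o == Some true) (s := s1) (b := b).
      by rewrite -sf /reads /s1 upd_neq.
    have run3 : runs (right1 i) (upd s1 f t) 1 (upd (upd s1 f t) i
        (scons (Some true) (scons (Some true) u), scons (Some false) rest)).
      by apply: runs_right1; rewrite upd_neq // /s1 upd_same.
    set s3 := upd _ i _ in run3.
    have run4 := run_end s3 (scons (Some true) (scons (Some true) u)).
    do 3!eexists; split.
    - apply: runs_to (runs_seq run1 (runs_seq (runs_if _) (run4 _ _))) erefl _.
      + by rewrite /reads /s1 upd_same; apply: runs_seq run2 run3.
      + by rewrite /s3 upd_same.
      + by rewrite /s3 /s1 !upd_neq.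
      + by [].
    - by rewrite upd_neq // upd_same.
    - by rewrite upd_same.
    - rewrite /reads /s3; upd_at; rewrite et eo //.
      by rewrite /s1 upd_neq.
  have {}run1 := run1 (scons (Some false) rest) si.
  set s1 := upd s0 i _ in run1.
  have [|t [run2 et]] := runs_check1 (i := f)
    (fun r => r o == Some false) (s := s1) (b := b).
    by rewrite -sf /reads /s1 upd_neq.
  have run4 := run_end (upd s1 f t) (scons (Some true) u).
  do 3!eexists; split.
  - apply: runs_to (runs_seq run1 (runs_seq (runs_if _) (run4 _ _))) erefl _.
    + by rewrite /reads /s1 upd_same; apply: run2.
    + by rewrite /s1 upd_neq // upd_same.
    + by rewrite /s1 !upd_neq.
    + by [].
  - by rewrite upd_neq // upd_same.
  - by rewrite upd_same.
  - rewrite /reads; upd_at; rewrite et eo //.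
    by rewrite /s1 upd_neq.
have loop : forall s u v e b, s i = (u, bits (unary_list (map nat_of_bool y)) r) ->
    s o = (v, nth None e) -> reads s f = Some b ->
    exists s' b', [/\ runs (whilem (fun r => r i == Some true)
      (seqm (right1 i) (seqm
        (ifm (fun r => r i == Some true)
           (seqm (check1 f (fun r => r o == Some true)) (right1 i))
           (check1 f (fun r => r o == Some false)))
        (seqm (right1 i) (right1 o))))) s (12 * size y + 1) s',
      reads s' f = Some b' &
      b' && (reads s' o == None) = b && (read_bits e == y)].
  elim: y {s u v e b si so sf} => [|b0 y IHy] s u v e b si so sf.
    exists s, b; split=> //; first by apply: runs_while_false; rewrite /reads si.
    by rewrite /reads so /stape_read /=; case: (e) => [|[]].
  have [s1 [u1 [v1 [run1 si1 so1 sf1]]]] := step _ _ _ _ _ _ _ si so sf.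
  have [s2 [b2 [run2 sf2 eb2]]] := IHy _ _ _ _ _ si1 so1 sf1.
  exists s2, b2; split=> //.
    apply: runs_to (runs_while_true _ run1 run2) erefl _ => /=; last by lia.
    by rewrite /reads si; case: (b0).
  rewrite eb2 -andbA; congr (_ && _).
  by case: (e) => [|[b1|] e'] //=; rewrite eqseq_cons.
have [s1 [b1 [run1 sf1 eb1]]] := loop _ _ _ _ _ si so sf.
have [t [run2 et]] := runs_check1 (fun r => r o == None) sf1.
exists (upd s1 f t); split; last by rewrite /reads upd_same et eb1.
by apply: runs_to (runs_seq run1 run2) erefl _;
  rewrite size_unary_list size_map; lia.
Qed.

End Routines.

(** * The verifier assembled from the routines *)

Section Verifier.
Variable M : TM.

Definition vtape := option (option (option 'I_(tm_work M).+1)).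

(* The inputs are [pair_enc (pair_enc x a) w] for an input [x], the advice [a]
   and a witness [w], which consists of a unary number selecting an entry of the
   advice, and of a self-delimiting string; the rest of [w] is padding. *)
Definition inp : vtape := None.
Definition adv : vtape := Some None.
Definition tab : vtape := Some (Some None).
Definition work i : vtape := Some (Some (Some i)).

Definition vvec (a b c d : stape) : vtape -> stape := fun j =>
  match j with
  | None => a
  | Some None => b
  | Some (Some None) => c
  | Some (Some (Some i)) => if i == ord0 then d else (blank, blank)
  end.

Lemma upd_vvec a b c d t :
  (upd (vvec a b c d) inp t = vvec t b c d) *
  (upd (vvec a b c d) adv t = vvec a t c d) *
  (upd (vvec a b c d) tab t = vvec a b t d) *
  (upd (vvec a b c d) (work ord0) t = vvec a b c t).
Proof.
split; [split; [split|]|]; apply: functional_extensionality => -[[[i|]|]|] //.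
by rewrite /upd -[_ == work ord0]/(i == ord0) /=; case: (i == ord0).
Qed.

(* An entry of the advice is a list of addresses, which spells out an instance
   when looked up in the table, together with a string. The leading bit of an
   entry tells whether there is another one. *)
Definition entry := (seq nat * seq bool)%type.

Definition entry_code (e : entry) : seq bool :=
  unary_list e.1 ++ unary_list (map nat_of_bool e.2).

Fixpoint advice (e : entry) (es : seq entry) : seq bool :=
  if es is e' :: es' then true :: entry_code e ++ advice e' es'
  else false :: entry_code e.

(** Total on purpose: a number that is too large selects the last entry, so every witness designates
    an entry of the advice. *)
Fixpoint select (e : entry) (es : seq entry) (w : seq bool) :
    entry * seq bool :=
  match es, w with
  | e' :: es', true :: w' => select e' es' w'
  | _, _ => (e, behead w)
  end.

(** After the two constants, each bit of [x] comes with its complement, so that a comparison with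
    either value is one look-up. The string [s] is supplied by the witness. *)
Definition table (x s : seq bool) : seq bool :=
  [:: false, true & flatten [seq [:: b; ~~ b] | b <- x] ++ s].

Definition write_bit : mach vtape :=
  act1 adv (fun r => (Some (bit_of (r inp)), MoveRight)).

Definition write_tab : mach vtape :=
  act1 tab (fun r => (Some (bit_of (r inp)), MoveRight)).

Definition write_both : mach vtape :=
  seqm (act1 tab (fun r => (Some (bit_of (r adv)), MoveRight)))
       (act1 tab (fun r => (Some (~~ bit_of (r adv)), MoveRight))).

Definition select_entry : mach vtape :=
  seqm (whilem (fun r => (r inp == Some true) && (r adv == Some true))
    (seqm (right1 inp) (seqm (right1 adv)
      (seqm (skip_list adv) (skip_list adv)))))
    (seqm (right1 inp) (right1 adv)).

Lemma runs_select e es w u v t o : exists u' v' r,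
  runs select_entry (vvec (u, bits w blank) (v, bits (advice e es) blank) t o)
    (30 * size (advice e es))
    (vvec (u', bits (select e es w).2 blank)
       (v', bits (entry_code (select e es w).1) r) t o).
Proof.
suff loop : exists u' v' b w' r,
    [/\ w' = [::] \/ behead w' = (select e es w).2 /\ w' != [::] ,
        w' = [::] -> (select e es w).2 = [::] &
    runs (whilem (fun r => (r inp == Some true) && (r adv == Some true))
    (seqm (right1 inp) (seqm (right1 adv)
      (seqm (skip_list adv) (skip_list adv)))))
      (vvec (u, bits w blank) (v, bits (advice e es) blank) t o)
      (30 * size (advice e es) - 20)
      (vvec (u', bits w' blank)
         (v', scons b (bits (entry_code (select e es w).1) r)) t o)].
  have [u' [v' [b [w' [r [ew' ew run1]]]]]] := loop.
  have [u2 run2] : exists u2, runs (right1 inp) (vvec (u', bits w' blank)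
         (v', scons b (bits (entry_code (select e es w).1) r)) t o) 1
         (vvec (u2, bits (select e es w).2 blank)
         (v', scons b (bits (entry_code (select e es w).1) r)) t o).
    exists (scons (bits w' blank 0) u').
    apply: runs_to (right1_any (i := inp) erefl) _ (leqnn _).
    rewrite upd_vvec; congr (vvec (_, _) _ _ _).
    case: ew' => [w'0|[<-]]; first by rewrite ew // w'0.
    by case: (w').
  exists u2, (scons b v'), r.
  apply: runs_to (runs_seq run1 (runs_seq run2
    (runs_right1 (i := adv) erefl))) _ _; first by rewrite upd_vvec.
  by case: (es) => [|? ?] /=; lia.
elim: es e w u v => [|e' es IHes] e w u v.
  exists u, v, (Some false), w, blank; split.
  - by case: w => [|b w]; [left|right].
  - by move=> ->.
  - by apply: runs_to (runs_while_false _ _) erefl _; rewrite /reads /= ?andbF //; lia.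
have stop : w = [::] \/ (exists w0, w = false :: w0) -> exists u' v' b w' r,
    [/\ w' = [::] \/ behead w' = (select e (e' :: es) w).2 /\ w' != [::] ,
        w' = [::] -> (select e (e' :: es) w).2 = [::] &
    runs (whilem (fun r => (r inp == Some true) && (r adv == Some true))
    (seqm (right1 inp) (seqm (right1 adv)
      (seqm (skip_list adv) (skip_list adv)))))
      (vvec (u, bits w blank) (v, bits (advice e (e' :: es)) blank) t o)
      (30 * size (advice e (e' :: es)) - 20)
      (vvec (u', bits w' blank)
         (v', scons b (bits (entry_code (select e (e' :: es) w).1) r)) t o)].
  move=> hw; exists u, v, (Some true), w, (bits (advice e' es) blank).
  case: hw => [->|[w0 ->]]; (split=> //; first by [left|right]);
  apply: runs_to (runs_while_false _ _) _ _ => //=;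
    rewrite ?bits_cat //; lia.
case: w stop => [|[] w] stop; [by apply: stop; left | |by apply: stop; right; exists w].
have [u' [v2 run2]] : exists u' v2,
    runs (seqm (right1 inp) (seqm (right1 adv)
      (seqm (skip_list adv) (skip_list adv))))
      (vvec (u, bits (true :: w) blank) (v, bits (advice e (e' :: es)) blank) t o)
      (8 * size (entry_code e) + 7)
      (vvec (u', bits w blank) (v2, bits (advice e' es) blank) t o).
  set s1 := vvec _ _ _ _.
  have r1 := runs_right1 (i := inp) (s := s1) erefl.
  rewrite upd_vvec in r1; set s2 := vvec _ _ _ _ in r1.
  have s2adv : s2 adv = (v, scons (Some true) (bits (unary_list e.1)
      (bits (unary_list (map nat_of_bool e.2)) (bits (advice e' es) blank)))).
    by rewrite /s2 /= /entry_code !bits_cat.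
  have r2 := runs_right1 s2adv.
  rewrite upd_vvec in r2; set s3 := vvec _ _ _ _ in r2.
  have [v3 r3] := runs_skip_list (i := adv) (s := s3) erefl.
  rewrite upd_vvec in r3; set s4 := vvec _ _ _ _ in r3.
  have [v4 r4] := runs_skip_list (i := adv) (s := s4) erefl.
  rewrite upd_vvec in r4.
  exists (scons (Some true) u), v4.
  apply: runs_to (runs_seq r1 (runs_seq r2 (runs_seq r3 r4))) erefl _.
  by rewrite /entry_code size_cat; lia.
have [u3 [v3 [b [w3 [r [ew3 ew run3]]]]]] := IHes e' w u' v2.
exists u3, v3, b, w3, r; split=> //.
apply: runs_to (runs_while_true _ run2 run3) erefl _ => //=.
have : 0 < size (advice e' es) by case: (es).
by rewrite size_cat; lia.
Qed.

Definition unwork (j : vtape) : option 'I_(tm_work M).+1 :=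
  if j is Some (Some (Some i)) then Some i else None.

Definition verifier : mach vtape :=
  seqm (undouble inp adv write_bit)
  (seqm (rewind adv)
  (seqm (act1 tab (fun=> (Some false, MoveRight)))
  (seqm (act1 tab (fun=> (Some true, MoveRight)))
  (seqm (undouble adv tab write_both)
  (seqm select_entry
  (seqm (undouble inp tab write_tab)
  (seqm (rewind_park tab)
  (seqm (gather adv tab (work ord0))
  (seqm (rewind (work ord0))
  (seqm (of_tm work unwork)
  (seqm (act1 inp (fun=> (Some true, Stay)))
    (compare adv (work ord0) inp)))))))))))).

Definition spelled (x : seq bool) (e : entry) (w : seq bool) : seq bool :=
  [seq nth false (table x (undbl w)) a | a <- e.1].

Lemma runs_verifier x e es w k (sel := select e es w)
    (c := iter k (@tm_step M) (tm_init M (spelled x sel.1 sel.2))) :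
  tm_halt c.1 -> exists s,
    runs verifier (@init_tapes _ (pair_enc (pair_enc x (advice e es)) w))
      (200 * (size (pair_enc x (advice e es)) + size (undbl sel.2)) + k + 100) s /\
    reads s inp = Some (tm_output c == sel.1.2).
Proof.
move=> hc; set z := pair_enc _ w; set y := pair_enc x _.
have -> : @init_tapes _ z = vvec (blank, bits z blank) (blank, blank)
    (blank, blank) (blank, blank).
  by apply: functional_extensionality => -[[[i|]|]|] //=; case: ifP.
set s1 := vvec _ _ _ _.
have [|u2] := @runs_undouble _ inp adv write_bit (fun b => [:: b])
    s1 z blank blank isT _ erefl erefl.
  by move=> s v sv; apply: runs_le (runs_act1 _) _ => //; rewrite sv.
rewrite !upd_vvec undbl_pair_enc undbl_end_pair_enc /=.
have flat1 (A : eqType) (s : seq A) : flatten [seq [:: b] | b <- s] = s.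
  by elim: s => //= b s ->.
rewrite flat1 -/y => r1; set s2 := vvec _ _ _ _ in r1.
have := @runs_rewind _ adv s2 (rev y) blank.
rewrite [rbits (rev y) _]rbits_rev revK -rbits_rev size_rev upd_vvec => /(_ erefl) r2.
set s3 := vvec _ _ _ _ in r2.
have r3 := @runs_act1 _ tab (fun=> (Some false, MoveRight)) s3 _ erefl.
rewrite upd_vvec in r3; set s4 := vvec _ _ _ _ in r3.
have r4 := @runs_act1 _ tab (fun=> (Some true, MoveRight)) s4 _ erefl.
rewrite upd_vvec in r4; set s5 := vvec _ _ _ _ in r4.
have [|u6] := @runs_undouble _ adv tab write_both (fun b => [:: b; ~~ b])
    s5 y blank (rbits [:: false; true] blank) isT _ erefl erefl.
  move=> s v sv; apply: runs_to (runs_seq (runs_act1 (i := tab) erefl)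
    (runs_act1 (i := tab) erefl)) _ _ => //.
  rewrite upd_upd; congr (upd _ _ _); rewrite upd_same sv /stape_update /=.
  by rewrite /reads upd_neq.
rewrite !upd_vvec undbl_pair_enc undbl_end_pair_enc -rbits_cat /= => r5.
set s6 := vvec _ _ _ _ in r5.
have [u7 [v7 [rest r6]]] := runs_select e es w u2 u6
  (rbits [:: false, true & flatten [seq [:: b; ~~ b] | b <- x]] blank, blank)
  (blank, blank).
rewrite -/sel -/s6 in r6; set s7 := vvec _ _ _ _ in r6.
have [|u8] := @runs_undouble _ inp tab write_tab (fun b => [:: b])
    s7 sel.2 u7 _ isT _ erefl erefl.
  by move=> s v sv; apply: runs_le (runs_act1 _) _ => //; rewrite sv.
rewrite !upd_vvec flat1 -rbits_cat !cat_cons -/(table x (undbl sel.2)) => r7.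
set t := table _ _ in r7; set s8 := vvec _ _ _ _ in r7.
have := @runs_rewind_park _ tab s8 (rev t) blank.
rewrite [rbits (rev t) _]rbits_rev revK -rbits_rev upd_vvec => /(_ erefl) r8.
set s9 := vvec _ _ _ _ in r8.
have s9adv : s9 adv = (v7, bits (unary_list sel.1.1)
    (bits (unary_list (map nat_of_bool sel.1.2)) rest)).
  by rewrite /s9 /= /entry_code bits_cat.
have [u10 [t10 r9]] := @runs_gather _ adv tab (work ord0) s9 sel.1.1 v7 _ t blank
   isT isT isT s9adv erefl erefl.
rewrite !upd_vvec -/(spelled x sel.1 sel.2) in r9.
set E := spelled _ _ _ in r9 c hc *; set s10 := vvec _ _ _ _ in r9.
have := @runs_rewind _ (work ord0) s10 (rev E) blank.
rewrite [rbits (rev E) _]rbits_rev revK -rbits_rev size_rev upd_vvec => /(_ erefl) r10.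
set s11 := vvec _ _ _ _ in r10.
have unworkK : ocancel unwork work by move=> [[[i|]|]|].
have s11M i : s11 (work i) = view ((tm_init M E).2 i).
  by rewrite /= ffunE /view; case: ifP; rewrite /= ?nth_bits nth_nil_blank.
have r11 := @runs_of_tm M vtape work unwork (fun i => erefl) unworkK E k s11 hc s11M.
rewrite -/c in r11; set s12 := (fun j => _) in r11.
have r12 := @runs_act1 _ inp (fun=> (Some true, Stay)) s12 _ erefl.
set s13 := upd _ _ _ in r12.
have [s14 [r13 e14]] := @runs_compare _ adv (work ord0) inp s13 sel.1.2
   u10 rest (nth None (c.2 ord0).1) (c.2 ord0).2 true isT isT isT erefl erefl erefl.
exists s14; split; last by [].
apply: runs_to (runs_seq r1 (runs_seq r2 (runs_seq r3 (runs_seq r4 (runs_seq r5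
  (runs_seq r6 (runs_seq r7 (runs_seq r8 (runs_seq r9 (runs_seq r10 (runs_seq r11
  (runs_seq r12 r13)))))))))))) erefl _.
have le_x : 2 * size x + size (advice e es) < size y by rewrite size_pair_enc.
have le_e : size (unary_list sel.1.1) +
    size (unary_list [seq nat_of_bool i | i <- sel.1.2]) <= size (advice e es).
  rewrite -size_cat -[_ ++ _]/(entry_code sel.1) /sel.
  elim: (es) (e) (w) => [|e' es' IH] e0 w0 /=; first by rewrite leqW.
  case: w0 => [|[] w0] /=; rewrite size_cat; try by lia.
  by apply: leq_trans (IH _ _) _; lia.
have sz_t : size t = 2 + 2 * size x + size (undbl sel.2).
  have -> : 2 * size x = size (flatten [seq [:: b; ~~ b] | b <- x]).
    by elim: (x) => //= ? ? <-; lia.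
  by rewrite /t /table /= size_cat.
have : size E <= size (unary_list sel.1.1).
  by rewrite size_unary_list size_map; lia.
rewrite size_rev /tm_output; move: le_x le_e sz_t.
move: (size _) (size _) (size _) (size _) (size _) (size _) (size _) (size _).
clear; lia.
Qed.

End Verifier.

(** * Accepting computations as a binary constraint satisfaction problem *)

Section LocalSteps.
Variable V : TM.
Notation tapes := 'I_(tm_work V).+1.

(* A halted machine is made to rewrite the symbols that it reads. *)
Definition local_step (c : tm_state V * {ffun tapes -> symbol}) :
    tm_state V * (tapes -> symbol * move) :=
  if tm_halt c.1 then (c.1, fun i => (c.2 i, Stay)) else
  let d := tm_delta c.1 c.2 in (d.1, fun i => d.2 i).

Definition sreads (s : tapes -> stape) : {ffun tapes -> symbol} :=
  [ffun i => stape_read (s i)].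

Definition stape_step (c : tm_state V * (tapes -> stape)) :=
  let d := local_step (c.1, sreads c.2) in
  (d.1, fun i => stape_update (c.2 i) (d.2 i)).

Definition stape_init (z : seq bool) : tapes -> stape :=
  fun i => if i == ord0 then (blank, bits z blank) else (blank, blank).

Lemma stape_step_iter z k (c := iter k (@tm_step V) (tm_init V z)) :
  iter k stape_step (tm_start V, stape_init z) = (c.1, fun i => view (c.2 i)).
Proof.
rewrite {}/c; elim: k => [|k IHk] /=.
  congr pair; apply: functional_extensionality => i; rewrite ffunE.
  by rewrite /stape_init /view; case: ifP; rewrite /= ?nth_bits nth_nil_blank.
rewrite IHk; move: (iter _ _ _) => [q ts] /=.
rewrite /stape_step /local_step /tm_step /=; case: ifP => /= _.
  congr pair; apply: functional_extensionality => i.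
  by rewrite ffunE update_stay.
have -> : sreads (fun i => view (ts i)) = [ffun i => tape_read (ts i)].
  by apply/ffunP => i; rewrite [LHS]ffunE [RHS]ffunE view_read.
case: tm_delta => q' d /=; congr pair; apply: functional_extensionality => i.
by rewrite !ffunE view_update.
Qed.

End LocalSteps.

(** Recovers a witness from the witness area of a satisfying assignment, where nothing follows a
    blank. *)
Lemma read_bits_nth (u : seq symbol) :
  (forall j, nth None u j = None -> nth None u j.+1 = None) ->
  forall j, nth None (map Some (read_bits u)) j = nth None u j.
Proof.
elim: u => [|[b|] u IHu] //= mono [|j] //=.
  by apply: IHu => k; apply: (mono k.+1).
have : nth None u j = None by elim: j => [|j]; [apply: (mono 0)|apply: (mono j.+1)].
by move=> ->.
Qed.

Lemma size_read_bits u : size (read_bits u) <= size u.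
Proof. by elim: u => // -[b|] u IHu. Qed.

Lemma nth_pair_enc_even x w j : j < size x ->
  nth None (map Some (pair_enc x w)) j.*2 = Some true.
Proof. by elim: x j => // b x IHx [|j] //= /IHx. Qed.

Lemma nth_pair_enc_odd x w j : j < size x ->
  nth None (map Some (pair_enc x w)) j.*2.+1 = Some (nth false x j).
Proof. by elim: x j => // b x IHx [|j] //= /IHx. Qed.

Lemma nth_pair_enc_rest x w j :
  nth None (map Some (pair_enc x w)) ((size x).*2 + j) =
  nth None (map Some (false :: w)) j.
Proof. by elim: x. Qed.

(** * The tableau of a computation with binary constraints *)

Section Tableau.
Variables (V : TM) (n W T : nat).

Notation tapes := 'I_(tm_work V).+1.

(** [T] cells of margin and [n.*2 + W + 1] for the longest input, with one to spare. *)
Definition head_pos := T + (n.*2 + W) + 2.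

Definition cell_var : finType := ('I_T.+1 * tapes * 'I_(head_pos.*2).+1)%type.

(* Every cell carries the state and the symbols read at its time step. *)
Definition cell_val : finType :=
  ((tm_state V * {ffun tapes -> symbol}) * symbol)%type.

(* Positions are relative to the head, which stays at [head_pos]. The window is
   wide enough for the junk entering at its ends, one cell per step, not to reach
   the head within [T] steps. *)
Definition content (t : stape) (p : nat) : symbol :=
  if p < head_pos then t.1 (head_pos - p.+1) else t.2 (p - head_pos).

Definition shifts (m : move) (p p' : nat) : bool :=
  match m with
  | MoveLeft => p' == p.+1 | Stay => p' == p | MoveRight => p == p'.+1
  end.

(** With the head fixed, a move shifts the whole tape, so each cell after a step depends on a single
    cell before it. This is what makes the transition constraint binary. *)
Lemma content_update t am p p' : shifts am.2 p p' ->
  content (stape_update t am) p' =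
  if p == head_pos then am.1 else content t p.
Proof.
have hp : 0 < head_pos by rewrite /head_pos addn2.
case: am => a [] /= /eqP ->;
  rewrite /content /stape_update /stl /scons /=.
- case: (ltngtP p head_pos) => [lt_p|gt_p|->].
  + case: ltnP => [lt_p1|].
      by congr (_ _); lia.
    move=> le_p; have -> : p.+1 - head_pos = 0 by lia.
    by have -> : head_pos - p.+1 = 0 by lia.
  + have -> : (p.+1 < head_pos) = false by lia.
    by have [-> ->] : p.+1 - head_pos = (p - head_pos.+1).+2 /\
      p - head_pos = (p - head_pos.+1).+1 by lia.
  + by rewrite ltnNge leqnSn /= subSnn.
- case: (ltngtP p head_pos) => [lt_p//|gt_p|->]; last by rewrite subnn.
  have [k ->] : exists k, p - head_pos = k.+1 by (exists (p - head_pos).-1; lia).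
  by [].
- case: (ltngtP p'.+1 head_pos) => [lt_p|gt_p|eq_p].
  + by have -> : head_pos - p'.+1 = (head_pos - p'.+2).+1 by lia.
  + by have -> : p'.+1 - head_pos = (p' - head_pos).+1 by lia.
  + by rewrite -eq_p subnn.
Qed.

(** The shape of [pair_enc x w] for unknown [x] and [w]: the odd positions below [n.*2] are the bits
    of [x], left to [choice_code], and the [W] cells after the delimiter are open for [w]. *)
Definition initial_symbol (i : tapes) (p : nat) (a : symbol) : bool :=
  if (i != ord0) || (p < head_pos) then a == None else
  let j := p - head_pos in
  if j < n.*2 then odd j || (a == Some true)
  else if j == n.*2 then a == Some false
  else (j <= n.*2 + W) || (a == None).

Definition cell_ok (v : cell_var) (d : cell_val) : bool :=
  let: (s, i, p) := v in
  [&& (p == head_pos :> nat) ==> (d.2 == d.1.2 i),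
      (s == 0 :> nat) ==> (d.1.1 == tm_start V) && initial_symbol i p d.2
    & (s == T :> nat) ==> [&& tm_halt d.1.1,
        (i == ord0) && (p == head_pos :> nat) ==> (d.2 == Some true) &
        (i == ord0) && (p == head_pos.+1 :> nat) ==> (d.2 == None)]].

(* The last clause makes the blanks of the witness area upward closed. *)
Definition cells_ok (v : cell_var) (d : cell_val) (v' : cell_var)
    (d' : cell_val) : bool :=
  let: (s, i, p) := v in let: (s', i', p') := v' in
  [&& (s == s') ==> (d.1 == d'.1),
      (s.+1 == s' :> nat) ==> (d'.1.1 == (local_step d.1).1) &&
        ((i == i') && shifts ((local_step d.1).2 i).2 p p' ==>
         (d'.2 == if p == head_pos :> nat then ((local_step d.1).2 i).1
                  else d.2))
    & [&& s == 0 :> nat, s' == 0 :> nat, i == ord0, i' == ord0,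
          p.+1 == p' :> nat, head_pos + n.*2 < p & d.2 == None] ==>
      (d'.2 == None)].

(* What the value [d] of [v] demands of the input: [inr (j, b)] demands that its
   [j]-th bit be [b]. *)
Definition choice_code (v : cell_var) (d : cell_val) : bool + nat * bool :=
  let: (s, i, p) := v in
  if ~~ cell_ok v d then inl false else
  if [&& s == 0 :> nat, i == ord0, head_pos <= p, odd (p - head_pos) &
         p - head_pos < n.*2]
  then if d.2 is Some b then inr ((p - head_pos)./2, b) else inl false
  else inl true.

Definition input_val (rho : nat -> bool -> bool) (c : bool + nat * bool) :=
  match c with inl b => b | inr (j, b) => rho j b end.

Definition satisfiable (rho : nat -> bool -> bool) : Prop :=
  exists A : cell_var -> cell_val,
    (forall v v', v != v' -> cells_ok v (A v) v' (A v')) /\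
    (forall v, input_val rho (choice_code v (A v))).

Lemma accept_satisfiable x w : size x = n -> size w <= W ->
  computes_within V T (pair_enc x w) [:: true] ->
  satisfiable (fun j b => nth false x j == b).
Proof.
move=> sz_x sz_w [halt_T out_T]; set z := pair_enc x w in halt_T out_T.
pose cfg s := iter s (@stape_step V) (tm_start V, stape_init z).
pose A (v : cell_var) : cell_val :=
  let: (s, i, p) := v in
  (((cfg s).1, sreads (cfg s).2), content ((cfg s).2 i) p).
have init_tape p : head_pos <= p ->
    content ((cfg 0).2 ord0) p = nth None (map Some z) (p - head_pos).
  by move=> le_p; rewrite /content ltnNge le_p /= bitsE.
have sz_z : size (map Some z) = (n.*2 + size w).+1.
  by rewrite size_map size_pair_enc sz_x mul2n.
have cell_okA v : cell_ok v (A v).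
  case: v => [[s i] p] /=; apply/and3P; split; apply/implyP => /eqP e.
  - by rewrite e /content ltnn subnn ffunE.
  - rewrite e eqxx /initial_symbol /=.
    case: eqP => [-> /=|/eqP neq_i /=]; last first.
      by rewrite /content /stape_init (negPf neq_i); case: ifP.
    case: ltnP => [lt_p|le_p]; first by rewrite /content lt_p.
    rewrite init_tape //; set j := p - head_pos; case: ltnP => lt_j.
      case: (boolP (odd j)) => //= even_j; have ej : j = j./2.*2 by lia.
      by rewrite [X in nth _ _ X]ej nth_pair_enc_even // sz_x; lia.
    case: eqP => [->|/eqP neq_j]; first by rewrite -sz_x -[_.*2]addn0 nth_pair_enc_rest.
    by case: leqP => //= gt_j; rewrite nth_default // sz_z; lia.
  - move: halt_T out_T; have := @stape_step_iter V z T; rewrite -/(cfg T) e.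
    move: (iter T _ _) => c -> /= -> /= out_T; apply/andP.
    have [r0 r1] : nth None (c.2 ord0).2 0 = Some true /\
                   nth None (c.2 ord0).2 1 = None.
      by move: out_T; rewrite /tm_output; case: (c.2 ord0).2 =>
        [|[[]|] [|[[]|] ?]].
    split; apply/implyP => /andP [/eqP -> /eqP ->]; rewrite /content.
      by rewrite ltnn subnn /= r0.
    by rewrite ltnNge leqnSn subSnn /= r1.
exists A; split=> [[[s i] p] [[s' i'] p'] _|v] /=.
  apply/and3P; split; apply/implyP.
  - by move=> /eqP ->.
  - move=> /eqP <-; rewrite -[cfg s.+1]/(stape_step (cfg s)) eqxx /=.
    apply/implyP => /andP [/eqP <- sh].
    by rewrite (content_update _ sh).
  - move=> /and5P [/eqP -> /eqP -> /eqP -> /eqP -> /and3P [/eqP <- lt_p /eqP]].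
    rewrite !init_tape; try lia.
    move=> b_p; apply/eqP; rewrite nth_default // leqNgt; apply/negP => lt_p1.
    have : p - head_pos < size (map Some z) by apply: leq_trans lt_p1; lia.
    by move=> /(mem_nth None); rewrite b_p => /mapP [].
have := cell_okA v; rewrite /choice_code; case: v => [[s i] p] -> /=.
case: ifP => // /and5P [/eqP -> /eqP -> le_p odd_p lt_p].
have ej : p - head_pos = (p - head_pos)./2.*2.+1 by lia.
by rewrite init_tape // [X in nth _ _ X]ej nth_pair_enc_odd /= ?eqxx // sz_x; lia.
Qed.

Lemma satisfiable_accept x : size x = n ->
  satisfiable (fun j b => nth false x j == b) ->
  exists w, size w <= W /\ computes_within V T (pair_enc x w) [:: true].
Proof.
move=> sz_x [A [A2 A1]].
pose get s i p := A (inord s, i, inord p).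
have le_head : head_pos <= head_pos.*2 by rewrite -addnn leq_addr.
have get_ok s i p : s <= T -> p <= head_pos.*2 ->
  [/\ p = head_pos -> (get s i p).2 = (get s i p).1.2 i,
      s = 0 -> (get s i p).1.1 = tm_start V /\ initial_symbol i p (get s i p).2 &
      s = T -> [/\ tm_halt (get s i p).1.1,
        i = ord0 -> p = head_pos -> (get s i p).2 = Some true &
        i = ord0 -> p = head_pos.+1 -> (get s i p).2 = None]].
  move=> le_s le_p; have := A1 (inord s, i, inord p); rewrite /choice_code.
  case: ifP => // /negbFE; rewrite -/(get s i p) /= !inordK //.
  move=> /and3P [h1 h2 h3] _; split=> [e|e|e].
  - by move: h1; rewrite e eqxx => /eqP.
  - by move: h2; rewrite e eqxx => /andP [/eqP].
  - move: h3; rewrite e eqxx => /and3P [-> h4 h5]; split=> // ei ep.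
      by move: h4; rewrite ei ep !eqxx => /eqP.
    by move: h5; rewrite ei ep !eqxx => /eqP.
have get_input p : head_pos <= p <= head_pos.*2 -> odd (p - head_pos) ->
    p - head_pos < n.*2 ->
    (get 0 ord0 p).2 = Some (nth false x (p - head_pos)./2).
  move=> /andP [le_p1 le_p2] odd_p lt_p.
  have := A1 (inord 0, ord0, inord p); rewrite /choice_code.
  case: ifP => // _; rewrite -/(get 0 ord0 p) /= !inordK //.
  by rewrite eqxx le_p1 odd_p lt_p /=; case: (get _ _ _).2 => //= b /eqP ->.
have get2 s i p s' i' p' : s <= T -> p <= head_pos.*2 -> s' <= T ->
    p' <= head_pos.*2 -> (s != s') || (i != i') || (p != p') ->
    cells_ok (inord s, i, inord p) (get s i p) (inord s', i', inord p')
      (get s' i' p').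
  move=> le_s le_p le_s' le_p' neq; apply: A2; apply: contraL neq.
  move=> /eqP [/(congr1 val) /= es -> /(congr1 val) /= ep].
  by move: es ep; rewrite !inordK // => -> ->; rewrite !eqxx.
pose c s := (get s ord0 head_pos).1.
have get_c s i p : s <= T -> p <= head_pos.*2 -> (get s i p).1 = c s.
  move=> le_s le_p; case: (boolP ((s != s) || (i != ord0) || (p != head_pos))).
    move=> /(get2 _ _ _ _ _ _ le_s le_p le_s le_head).
    by rewrite /cells_ok eqxx => /and3P [/eqP].
  by rewrite eqxx /= negb_or !negbK => /andP [/eqP -> /eqP ->].
pose u := [seq (get 0 ord0 (head_pos + n.*2.+1 + j)).2 | j <- iota 0 W].
have nth_u j : j < W -> nth None u j = (get 0 ord0 (head_pos + n.*2.+1 + j)).2.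
  by move=> lt_j; rewrite (nth_map 0) ?size_iota // nth_iota.
have u_mono j : nth None u j = None -> nth None u j.+1 = None.
  case: (ltnP j.+1 W) => [lt_j|le_j _]; last first.
    by rewrite nth_default // size_map size_iota.
  rewrite !nth_u ?(ltnW lt_j) // => ej.
  have := @get2 0 ord0 (head_pos + n.*2.+1 + j) 0 ord0
    (head_pos + n.*2.+1 + j.+1) isT.
  have -> : head_pos + n.*2.+1 + j <= head_pos.*2 by rewrite /head_pos; lia.
  have -> : head_pos + n.*2.+1 + j.+1 <= head_pos.*2 by rewrite /head_pos; lia.
  have -> : (head_pos + n.*2.+1 + j != head_pos + n.*2.+1 + j.+1) by lia.
  rewrite !orbT => /(_ isT isT isT isT) /and3P [_ _].
  rewrite !inordK //; try by rewrite /head_pos; lia.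
  rewrite [_ + j.+1]addnS !eqxx ej eqxx /=.
  have -> : head_pos + n.*2 < head_pos + n.*2.+1 + j by lia.
  by move=> /eqP.
pose w := read_bits u; exists w.
have sz_w : size w <= W.
  by apply: leq_trans (size_read_bits _) _; rewrite size_map size_iota.
split=> //; set z := pair_enc x w.
have sym0 p : head_pos <= p <= head_pos.*2 ->
    (get 0 ord0 p).2 = nth None (map Some z) (p - head_pos).
  move=> /andP [le_p1 le_p2]; have [_ /(_ erefl) [_]] := get_ok 0 ord0 p isT le_p2.
  rewrite /initial_symbol /= ltnNge le_p1 /= => + _.
  case: ltnP => lt_j.
    case: (boolP (odd _)) => [odd_p _|even_p /= /eqP ->].
      rewrite get_input ?le_p1 //.
      have ej : p - head_pos = (p - head_pos)./2.*2.+1 by lia.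
      by rewrite [X in _ = nth _ _ X]ej nth_pair_enc_odd // sz_x; lia.
    have ej : p - head_pos = (p - head_pos)./2.*2 by lia.
    by rewrite ej nth_pair_enc_even // sz_x; lia.
  case: eqP => [-> /eqP ->|neq_j].
    by rewrite -sz_x -[_.*2]addn0 nth_pair_enc_rest.
  set k := p - head_pos - n.*2.+1.
  have -> : p - head_pos = (size x).*2 + k.+1 by rewrite sz_x /k; lia.
  rewrite nth_pair_enc_rest /= read_bits_nth //.
  case: (ltnP k W) => [lt_k _|le_k].
    by rewrite nth_u // /k; congr (get _ _ _).2; lia.
  rewrite leqNgt (_ : _ < _ = true) /=; last by rewrite sz_x; lia.
  by move=> /eqP ->; rewrite nth_default // size_map size_iota.
pose cfg s := iter s (@stape_step V) (tm_start V, stape_init z).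
(* Border cells may lack a predecessor in the window, so the interval of agreement loses a cell at
   each end per step; at time [T] it still contains the two cells that decide the output. *)
have inv s : s <= T -> (c s).1 = (cfg s).1 /\ forall i p,
    s <= p <= head_pos.*2 - s -> (get s i p).2 = content ((cfg s).2 i) p.
  elim: s => [|s IHs] le_s.
    split; first by have [_ /(_ erefl) []] := get_ok 0 ord0 head_pos isT le_head.
    move=> i p; rewrite subn0 /= => le_p.
    have [_ /(_ erefl) [_]] := get_ok 0 i p isT le_p.
    rewrite /initial_symbol /content /stape_init.
    case: (i =P ord0) => [-> /=|_ /= /eqP -> _]; last by case: ifP.
    case: ltnP => [lt_p /eqP -> //|le_p1 _ _].
    by rewrite sym0 ?le_p1 // bitsE.
  have [es esym] := IHs (ltnW le_s).
  have head_ok : s < head_pos by rewrite /head_pos; lia.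
  have ec : c s = ((cfg s).1, sreads (cfg s).2).
    rewrite [LHS]surjective_pairing es; congr pair; apply/ffunP => i.
    have [/(_ erefl) + _ _] := get_ok s i head_pos (ltnW le_s) le_head.
    rewrite get_c ?(ltnW le_s) // => <-; rewrite esym; last by lia.
    by rewrite /content ltnn subnn ffunE.
  have next i p p' : p <= head_pos.*2 -> p' <= head_pos.*2 ->
      (c s.+1).1 = (local_step (c s)).1 /\
      (shifts ((local_step (c s)).2 i).2 p p' ->
       (get s.+1 i p').2 = if p == head_pos then ((local_step (c s)).2 i).1
                           else (get s i p).2).
    move=> le_p le_p'.
    have := @get2 s i p s.+1 i p' (ltnW le_s) le_p le_s le_p' _.
    rewrite neq_ltn ltnSn /= => /(_ isT) /and3P [_ + _].
    rewrite !inordK //; last exact: ltnW.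
    rewrite !eqxx /= !get_c ?(ltnW le_s) // => /andP [/eqP -> h]; split=> // sh.
    by move: h; rewrite sh => /eqP.
  have step : cfg s.+1 = ((local_step (c s)).1,
      fun i => stape_update ((cfg s).2 i) ((local_step (c s)).2 i)).
    by rewrite ec.
  split; first by have [-> _] := next ord0 head_pos head_pos le_head le_head;
    rewrite step.
  move=> i p' /andP [le_p1 le_p2].
  have [p [sh le_p]] : exists p, shifts ((local_step (c s)).2 i).2 p p' /\
      s <= p <= head_pos.*2 - s.
    case: (_.2) => /=; [exists p'.-1|exists p'|exists p'.+1]; split; lia.
  have [_ ->] := next i p p' ltac:(lia) ltac:(lia); last by [].
  by rewrite step /= (content_update _ sh) esym.
have [eT symT] := inv T (leqnn T).
have h0 : T <= head_pos <= head_pos.*2 - T by rewrite /head_pos; lia.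
have h1 : T <= head_pos.+1 <= head_pos.*2 - T by rewrite /head_pos; lia.
have [_ _ /(_ erefl) [halt_T /(_ erefl erefl) r0 _]] :=
  get_ok T ord0 head_pos (leqnn T) le_head.
have [_ _ /(_ erefl) [_ _ /(_ erefl erefl) r1]] :=
  get_ok T ord0 head_pos.+1 (leqnn T) ltac:(lia).
move: halt_T; rewrite get_c // eT; move: r0 r1; rewrite !symT //.
rewrite /content ltnn subnn ltnNge leqnSn subSnn /cfg stape_step_iter /=.
by move=> r0 r1 hT; split=> //; apply: read_bits_view.
Qed.

Lemma satisfiable_ext rho rho' :
  (forall j b, j < n -> rho j b = rho' j b) -> satisfiable rho -> satisfiable rho'.
Proof.
move=> eq_rho [A [A2 A1]]; exists A; split=> // v; move: (A1 v).
rewrite /choice_code; case: v => [[s i] p]; case: ifP => //.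
case: ifP => // /and5P [_ _ le_p odd_p lt_p] _; case: (_.2) => //= b.
by rewrite eq_rho // ltn_half_double.
Qed.

End Tableau.

(** * The clique instances and their templates *)

Lemma size_enc_nat n : size (enc_nat n) = n.+1.
Proof. by rewrite size_rcons size_nseq. Qed.

Section CliqueCSP.
Variables (X D : finType) (ok : X -> D -> X -> D -> bool).
Variables (code : X -> D -> bool + nat * bool) (t : nat).

(* The vertices are the assignments of a single variable, and the choices of
   one among [t] inputs. *)
Definition vertex : finType := (X * D + 'I_t)%type.

(** Adjacency is kept symbolic, as a constant or as the question whether bit [j] of input [i] is
    [b], so that one template serves all tuples of inputs. *)
Definition edge_code (a b : vertex) : bool + 'I_t * (nat * bool) :=
  match a, b with
  | inl (v, d), inl (v', d') => inl [&& v != v', ok v d v' d' & ok v' d' v d]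
  | inl (v, d), inr i | inr i, inl (v, d) =>
      match code v d with inl c => inl c | inr jb => inr (i, jb) end
  | inr _, inr _ => inl false
  end.

Definition edge_val (rho : 'I_t -> nat -> bool -> bool)
    (c : bool + 'I_t * (nat * bool)) : bool :=
  match c with inl b => b | inr (i, (j, b)) => rho i j b end.

Lemma edge_code_sym a b : edge_code a b = edge_code b a.
Proof.
case: a b => [[v d]|i] [[v' d']|i'] //=.
by rewrite eq_sym [ok v d v' d' && _]andbC.
Qed.

Lemma edge_code_irr a : edge_code a a = inl false.
Proof. by case: a => [[v d]|i] //=; rewrite eqxx. Qed.

(** The vertices split into [#|X|.+1] independent sets, one per variable and one for the choice of
    an input. A clique of that size meets each of them exactly once. *)
Lemma clique_satisfiable rho :
  (exists S : {set vertex}, #|S| = #|X|.+1 /\ forall a b, a \in S -> b \in S ->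
     a != b -> edge_val rho (edge_code a b)) <->
  exists (i : 'I_t) (A : X -> D),
    (forall v v', v != v' -> ok v (A v) v' (A v')) /\
    (forall v, input_val (rho i) (code v (A v))).
Proof.
split=> [[S [cardS cliqueS]]|[i [A [A2 A1]]]]; last first.
  have val_choice v : edge_val rho (edge_code (inl (v, A v)) (inr i)).
    by move: (A1 v) => /=; case: code => // -[].
  exists (inr i |: [set inl (v, A v) | v : X]); split.
    rewrite cardsU1 card_imset => [|v v' [] //].
    by rewrite (_ : _ \notin _ = true) //; apply/imsetP => -[].
  move=> a b; rewrite !inE => /orP [/eqP ->|/imsetP [v _ ->]].
    case/orP => [/eqP ->|/imsetP [v _ -> _]]; first by rewrite eqxx.
    by rewrite edge_code_sym.
  case/orP => [/eqP -> //|/imsetP [v' _ ->] neq].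
  have neq_v : v != v' by apply: contra neq => /eqP ->.
  by rewrite /= neq_v !A2 // eq_sym.
pose f (a : vertex) : option X := if a is inl (v, _) then Some v else None.
have f_inj : {in S &, injective f}.
  move=> a b aS bS eq_f; apply/eqP; apply: contraT => neq.
  have := cliqueS a b aS bS neq.
  case: a b eq_f {aS bS neq} => [[v d]|i] [[v' d']|i'] //=.
  by move=> [->]; rewrite eqxx.
have imS : f @: S = setT.
  by apply/eqP; rewrite eqEcard subsetT cardsT (card_in_imset f_inj) card_option cardS leqnn.
have [i iS] : exists i, inr i \in S.
  have : None \in f @: S by rewrite imS.
  by case/imsetP => -[[v d]|i] // iS _; exists i.
have valS v : exists d, inl (v, d) \in S.
  have : Some v \in f @: S by rewrite imS.
  by case/imsetP => -[[v' d]|//] aS [->]; exists d.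
pose A v := xchoose (valS v).
have AS v : inl (v, A v) \in S by apply: xchooseP (valS v).
exists i, A; split=> [v v' neq|v].
  have := cliqueS _ _ (AS v) (AS v') _.
  have -> : inl (v, A v) != inl (v', A v') :> vertex.
    by apply: contra neq => /eqP [->].
  by move=> /(_ isT) /= /and3P [].
by have := cliqueS _ _ (AS v) iS isT; rewrite /=; case: code => // -[].
Qed.

(** A vertex outside the image of [f] has at most one neighbour, hence lies in no clique of more
    than two vertices. *)
Lemma has_clique_transfer (H : graph) (e : rel vertex)
    (f : vertex -> 'I_(order H)) k :
  injective f -> (forall a b, edge (f a) (f b) = e a b) ->
  (forall z y y', z \notin codom f -> edge z y -> edge z y' -> y = y') -> 2 < k ->
  has_clique H k <-> exists S : {set vertex}, #|S| = k /\
    forall a b, a \in S -> b \in S -> a != b -> e a b.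
Proof.
move=> f_inj fe isolated k_gt2; split=> [[S [cS cardS]]|[S [cardS cS]]].
  have S_f z : z \in S -> z \in codom f.
    move=> zS; apply: contraT => z_out.
    have : 1 < #|S :\ z| by move: k_gt2; rewrite -cardS (cardsD1 z) zS; lia.
    case/card_gt1P => y [y' [yS y'S]]; move: yS y'S; rewrite !inE.
    move=> /andP [neq_y yS] /andP [neq_y' y'S].
    rewrite (isolated z y y') ?eqxx //.
    - by apply: cS; rewrite // eq_sym.
    - by apply: cS; rewrite // eq_sym.
  exists (f @^-1: S); split.
    rewrite -cardS -(card_imset _ f_inj); apply: eq_card => z.
    apply/imsetP/idP => [[a]|zS]; first by rewrite inE => ? ->.
    by have /codomP [a ez] := S_f z zS; exists a; rewrite // inE -ez.
  move=> a b; rewrite !inE => aS bS neq; rewrite -fe; apply: cS => //.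
  by apply: contra neq => /eqP /f_inj ->.
exists (f @: S); split; last by rewrite card_imset.
move=> x y /imsetP [a aS ->] /imsetP [b bS ->] neq; rewrite fe; apply: cS => //.
by apply: contra neq => /eqP ->.
Qed.

(* Two isolated vertices are added: the new edge joins them, and the new vertex
   is isolated as well, so that neither modification matters. *)
Definition padded : finType := option (option vertex).

Definition old_code (x y : 'I_#|padded|) : bool + 'I_t * (nat * bool) :=
  match enum_val x, enum_val y with
  | Some (Some a), Some (Some b) => edge_code a b
  | _, _ => inl false
  end.

Lemma old_code_sym x y : old_code x y = old_code y x.
Proof.
by rewrite /old_code; case: (enum_val x) (enum_val y) => [[a|]|] [[b|]|];
  rewrite // edge_code_sym.
Qed.

Lemma old_code_irr x : old_code x x = inl false.
Proof. by rewrite /old_code; case: (enum_val x) => [[a|]|]; rewrite // edge_code_irr. Qed.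

Section Instance.
Variable rho : 'I_t -> nat -> bool -> bool.

Definition template_edge : rel 'I_#|padded| :=
  fun x y => edge_val rho (old_code x y).

Lemma template_edge_sym : symmetric template_edge.
Proof. by move=> x y; rewrite /template_edge old_code_sym. Qed.

Lemma template_edge_irr : irreflexive template_edge.
Proof. by move=> x; rewrite /template_edge old_code_irr. Qed.

Definition template_graph : graph := Graph template_edge_sym template_edge_irr.

Definition pad1 : 'I_(order template_graph) := enum_rank (None : padded).
Definition pad2 : 'I_(order template_graph) := enum_rank (Some None : padded).

Definition modified_graph (lm : modification) : graph :=
  match lm with
  | EdgeAddition => add_edge pad1 pad2
  | VertexAddition => @add_vertex template_graph set0
  end.

Definition template_instance (lm : modification) : reopt_instance :=
  {| old_graph := template_graph; old_k := 0; old_sol := Some set0;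
     new_graph := modified_graph lm; new_k := #|X|.+1 |}.

Lemma neq_pads : pad1 != pad2.
Proof. by apply/eqP => /enum_rank_inj. Qed.

Lemma template_instance_valid lm : valid_instance lm (template_instance lm).
Proof.
split=> //; first by split=> // x y; rewrite inE.
case: lm => /=; last exact: ModVertex.
apply: ModEdge; first exact: neq_pads.
by rewrite /= /template_edge /old_code !enum_rankK.
Qed.

Definition embed (lm : modification) : vertex -> 'I_(order (modified_graph lm)) :=
  match lm with
  | EdgeAddition => fun a => enum_rank (Some (Some a) : padded)
  | VertexAddition => fun a => lift ord_max (enum_rank (Some (Some a) : padded))
  end.

Lemma template_instance_clique lm : 1 < #|X| ->
  has_clique (modified_graph lm) #|X|.+1 <->
  exists (i : 'I_t) (A : X -> D),
    (forall v v', v != v' -> ok v (A v) v' (A v')) /\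
    (forall v, input_val (rho i) (code v (A v))).
Proof.
move=> X_gt1; rewrite -clique_satisfiable.
have inj_rank : injective (fun a => enum_rank (Some (Some a) : padded)).
  by move=> a b /enum_rank_inj [].
have isolated z : z \notin codom (fun a => enum_rank (Some (Some a) : padded)) ->
    forall y, template_edge z y = false.
  move=> z_out y; rewrite /template_edge /old_code.
  case ez: (enum_val z) => [[a|]|] //; case/negP: z_out.
  by apply/codomP; exists a; rewrite -ez enum_valK.
apply: (@has_clique_transfer (modified_graph lm)
  (fun a b => edge_val rho (edge_code a b)) (embed lm)) => //; case: lm => /=.
- exact: inj_rank.
- by move=> a b /lift_inj /inj_rank.
- move=> a b; rewrite /add_edge_rel /= /template_edge /old_code !enum_rankK.
  rewrite [X in _ || X](_ : _ = false) ?orbF //.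
  apply/negbTE; rewrite negb_and; apply/orP; right; apply/eqP => /setP.
  move=> /(_ (enum_rank (Some (Some a) : padded))).
  by rewrite !inE eqxx !(inj_eq enum_rank_inj).
- by move=> a b; rewrite /add_vertex_rel !liftK /= /template_edge /old_code
    !enum_rankK.
- move=> z y y' z_out; rewrite /add_edge_rel /= !isolated //=.
  move=> /andP [neq_y /eqP ey] /andP [neq_y' /eqP ey'].
  have : y \in [set z; y'] by rewrite ey' -ey !inE eqxx orbT.
  by rewrite !inE eq_sym (negPf neq_y) => /eqP.
- move=> z y y' z_out; rewrite /add_vertex_rel; case: unliftP => [i|] ez.
    case: unliftP => [j|] _; rewrite ?inE //= isolated //.
    by apply: contra z_out => /codomP [a ei]; apply/codomP; exists a; rewrite ez ei.
  by case: unliftP => [j|] _; rewrite ?inE.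
Qed.

End Instance.

Definition edge_codes (N : nat) (g : 'I_N -> 'I_N -> bool + 'I_t * (nat * bool)) :=
  [seq g x y | x <- enum 'I_N, y <- enum 'I_N].

Definition new_code (lm : modification) :
    seq (bool + 'I_t * (nat * bool)) :=
  match lm with
  | EdgeAddition =>
      map inl (enc_nat #|padded|) ++ edge_codes (fun x y =>
        if (x != y) && ([set x; y] == [set enum_rank (None : padded);
          enum_rank (Some None : padded)]) then inl true else old_code x y)
  | VertexAddition =>
      map inl (enc_nat #|padded|.+1) ++ edge_codes (fun x y =>
        match unlift ord_max x, unlift ord_max y with
        | Some i, Some j => old_code i j
        | _, _ => inl false
        end)
  end.

(** The encoded instance before the inputs are known. Its length does not depend on them, so neither
    does the time allotted to the kernel. *)
Definition template (lm : modification) : seq (bool + 'I_t * (nat * bool)) :=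
  ((map inl (enc_nat #|padded|) ++ edge_codes old_code) ++
     map inl (enc_nat 0)) ++
  (inl true :: [seq inl false | x <- enum 'I_#|padded|]) ++
  new_code lm ++ map inl (enc_nat #|X|.+1).

Lemma templateP rho lm :
  map (edge_val rho) (template lm) = enc_instance (template_instance rho lm).
Proof.
have constK s : map (edge_val rho) (map inl s) = s.
  by rewrite -map_comp map_id_in.
rewrite /template /enc_instance /enc_clique /enc_graph !map_cat !constK map_allpairs.
congr (_ ++ (_ ++ _)).
  rewrite /= -map_comp; congr (_ :: _); apply: eq_map => x.
  by rewrite /= inE.
congr (_ ++ _); case: lm; rewrite [LHS]map_cat constK [X in _ ++ X]map_allpairs;
  congr (_ ++ _); apply: eq_allpairs => x y.
- by case: ifP => e /=; rewrite /add_edge_rel [X in _ || X]e ?orbT ?orbF.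
- rewrite [RHS]/= /add_vertex_rel; case: unliftP => [i|] _; case: unliftP => [j|] _;
  by rewrite ?inE.
Qed.

Lemma size_edge_codes N (g : 'I_N -> 'I_N -> bool + 'I_t * (nat * bool)) :
  size (edge_codes g) = N * N.
Proof. by rewrite size_allpairs size_enum_ord. Qed.

Lemma size_template lm (N := #|padded|) :
  size (template lm) <= 2 * (N * N) + 6 * N + #|X| + 10.
Proof.
have sz_new : size (new_code lm) <= N * N + 3 * N + 3.
  case: lm; rewrite /new_code size_cat size_map size_enc_nat size_edge_codes /N;
  by move: #|padded| => m; nia.
have sz_sol : size ([seq inl false | x <- enum 'I_#|padded|] :
    seq (bool + 'I_t * (nat * bool))) = N by rewrite size_map size_enum_ord.
rewrite /template; move: sz_new sz_sol; rewrite /N; set sol := map _ _ => sz_new sz_sol.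
rewrite !size_cat ![size (_ :: _)]/= sz_sol !size_map !size_enc_nat size_edge_codes.
move: sz_new; move: #|padded| #|X| (size (new_code _)) => m1 m2 m3.
by clear; lia.
Qed.

End CliqueCSP.

(** * Addresses of instance bits in the table *)

Section Addresses.
Variables (n t : nat) (p : 'I_t).

(* The table for input [p]: the two constants, input [p] together with its
   complement, and the comparisons of all of the [t] inputs with both bits. *)
Definition address (c : bool + 'I_t * (nat * bool)) : nat :=
  match c with
  | inl b => nat_of_bool b
  | inr (i, (j, b)) =>
      if j < n then
        if i == p then 2 + (2 * j + ~~ b) else 2 + (2 * n + (2 * (j * t + i) + ~~ b))
      else 0
  end.

Lemma address_bound c : address c <= 2 + 2 * n + 2 * (n * t).
Proof.
case: c => [[]|[i [j b]]] //=; case: ifP => // lt_jn.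
have : j * t + i < n * t by have := ltn_ord i; nia.
by case: ifP => _; case: b => /=; lia.
Qed.

(** The test [j < n] mirrors the default address 0 in [address], where the table holds [false]. *)
Definition input_rows (xs : 'I_t -> seq bool) : 'I_t -> nat -> bool -> bool :=
  fun i j b => (j < n) && (nth false (xs i) j == b).

Definition table_rows (x s : seq bool) : 'I_t -> nat -> bool -> bool :=
  fun i j b => nth false (table x s) (address (inr (i, (j, b)))).

Lemma nth_table_address x s c :
  nth false (table x s) (address c) = edge_val (table_rows x s) c.
Proof. by case: c => [[]|[i [j b]]]. Qed.

(** Index [m] stands for the triple with [m = 2 * (j * t + i) + ~~ b], the numbering used by
    [address]. *)
Definition row_bits (xs : 'I_t -> seq bool) : seq bool :=
  mkseq (fun m => if insub (m./2 %% t) is Some i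
                  then nth false (xs i) (m./2 %/ t) == ~~ odd m else false)
    (2 * (n * t)).

Lemma nth_complemented x j b s : j < size x ->
  nth false (flatten [seq [:: b; ~~ b] | b <- x] ++ s) (2 * j + ~~ b) =
  (nth false x j == b).
Proof.
elim: x j => // c x IHx [|j] lt_j; first by case: (b); case: (c).
have -> : 2 * j.+1 + ~~ b = (2 * j + ~~ b).+2 by case: (b); lia.
exact: IHx.
Qed.

Lemma size_complemented (x : seq bool) :
  size (flatten [seq [:: b; ~~ b] | b <- x]) = 2 * size x.
Proof. by elim: x => //= b x ->; rewrite mulnS. Qed.

Lemma table_rows_self x s j b : size x = n -> j < n ->
  table_rows x s p j b = (nth false x j == b).
Proof.
move=> sz_x lt_j; rewrite /table_rows /= lt_j eqxx /=.
by rewrite nth_complemented ?sz_x.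
Qed.

Lemma table_rows_bits xs : size (xs p) = n ->
  table_rows (xs p) (row_bits xs) = input_rows xs.
Proof.
move=> sz_x; apply: functional_extensionality => i.
apply: functional_extensionality => j; apply: functional_extensionality => b.
rewrite /input_rows; case: ltnP => [lt_j|le_j] /=; last first.
  by rewrite /table_rows /= ltnNge le_j.
case: (i =P p) => [->|/eqP neq_ip]; first exact: table_rows_self.
rewrite /table_rows /= lt_j (negPf neq_ip) /=.
have lt_i := ltn_ord i; have t_gt0 : 0 < t by apply: leq_trans lt_i.
rewrite nth_cat size_complemented sz_x ltnNge leq_addr /= add0n addKn nth_mkseq; last first.
  by case: b => /=; nia.
have -> : (2 * (j * t + i) + ~~ b)./2 = j * t + i by lia.
have -> : odd (2 * (j * t + i) + ~~ b) = ~~ b by lia.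
by rewrite modnMDl modn_small // divnMDl // divn_small // addn0 valK negbK.
Qed.

End Addresses.

(** * Covering the no-instances by few outputs *)

Section Covering.
Variables (U Y : finType) (t : nat) (f : {ffun 'I_t -> U} -> Y).
Hypotheses (t_gt0 : 0 < t) (card_Y : #|Y| <= 2 ^ t).

Definition covered (A : {set U}) (p : 'I_t) (y : Y) : {set U} :=
  [set x in A | [exists X : {ffun 'I_t -> U},
     [&& X \in ffun_on (mem A), X p == x & f X == y]]].

Lemma leq_foldr_muln (I : Type) (s : seq I) (c : I -> nat) m :
  (forall i, 2 * c i <= m) ->
  2 ^ size s * foldr muln 1 (map c s) <= m ^ size s.
Proof.
move=> le_c; elim: s => //= i s IHs; rewrite !expnS mulnACA.
exact: leq_mul (le_c i) IHs.
Qed.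

(* The tuples over [A] sent to [y] have their entry [p] in [covered A p y]. If
   all of these sets were smaller than [#|A| / 2], there would be too few tuples
   over [A]. *)
Lemma cover_half (A : {set U}) : A != set0 ->
  exists p y, #|A| <= 2 * #|covered A p y|.
Proof.
move=> A_neq0; case: (boolP [exists p, [exists y, #|A| <= 2 * #|covered A p y|]]).
  by case/existsP => p /existsP [y]; exists p, y.
rewrite negb_exists => /forallP small; exfalso.
(* The predecessor keeps the inequality strict once it is raised to the power [t]. *)
have {}small p y : 2 * #|covered A p y| <= #|A|.-1.
  have := small p; rewrite negb_exists => /forallP /(_ y); lia.
have A_gt0 : 0 < #|A| by rewrite card_gt0.
have fiber y : 2 ^ t * #|[pred X | (X \in ffun_on (mem A)) && (f X == y)]| <=
    #|A|.-1 ^ t.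
  have le_fam : #|[pred X | (X \in ffun_on (mem A)) && (f X == y)]| <=
      foldr muln 1 [seq #|covered A p y| | p <- enum 'I_t].
    rewrite -(card_family (fun p => mem (covered A p y))); apply: subset_leq_card.
    apply/subsetP => X; rewrite inE => /andP [XA fX]; apply/familyP => p.
    rewrite inE; apply/andP; split; first by move/ffun_onP: XA; apply.
    by apply/existsP; exists X; rewrite XA fX eqxx.
  apply: leq_trans (leq_mul (leqnn _) le_fam) _.
  have := leq_foldr_muln (enum 'I_t) (fun p => small p y).
  by rewrite size_enum_ord.
have : 2 ^ t * #|A| ^ t <= 2 ^ t * #|A|.-1 ^ t.
  have := card_ffun_on 'I_t (mem A); rewrite card_ord => <-.
  rewrite -[in leqLHS]sum1_card (partition_big f xpredT) //= big_distrr /=.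
  apply: leq_trans (_ : \sum_(y : Y) #|A|.-1 ^ t <= _); last first.
    by rewrite sum_nat_const leq_mul2r card_Y orbT.
  by apply: leq_sum => y _; rewrite sum1_card; apply: fiber.
rewrite leq_pmul2l ?expn_gt0 // leq_exp2r //; lia.
Qed.

(** Each round removes at least half of what is left, and the tuples of later rounds are still
    tuples over [A]. The second clause serves soundness, the third completeness. *)
Lemma cover_all m (A : {set U}) : #|A| < 2 ^ m ->
  exists es : seq ('I_t * Y),
  [/\ size es <= m,
      forall e, e \in es -> exists2 X, X \in ffun_on (mem A) & f X = e.2 &
      forall x, x \in A -> exists2 e, e \in es &
        exists X, [/\ X \in ffun_on (mem A), X e.1 = x & f X = e.2]].
Proof.
elim: m A => [|m IHm] A.
  rewrite ltnS leqn0 cards_eq0 => /eqP ->; exists [::].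
  by split=> // x; rewrite inE.
move=> le_A; case: (A =P set0) => [->|/eqP A_neq0].
  by exists [::]; split=> // x; rewrite inE.
have [p [y half]] := cover_half A_neq0; set C := covered A p y in half.
have sCA : C \subset A by apply/subsetP => x; rewrite inE => /andP [].
have := cardsID C A; rewrite (setIidPr sCA) => cardA.
have [|es [le_es es_out es_cover]] := IHm (A :\: C).
  by move: le_A; rewrite expnS; lia.
have on_A X : X \in ffun_on (mem (A :\: C)) -> X \in ffun_on (mem A).
  move/ffun_onP => XA; apply/ffun_onP => i.
  by have := XA i; rewrite inE => /andP [].
exists ((p, y) :: es); split=> //.
- move=> e; rewrite inE => /orP [/eqP ->|/es_out [X /on_A XA fX]]; last by exists X.
  have : 0 < #|C| by move: A_neq0; rewrite -card_gt0; lia.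
  case/card_gt0P => x; rewrite inE => /andP [_ /existsP [X /and3P [XA _ /eqP fX]]].
  by exists X.
- move=> x xA; case: (boolP (x \in C)) => [|xC].
    rewrite inE => /andP [_ /existsP [X /and3P [XA /eqP Xp /eqP fX]]].
    by exists (p, y); [rewrite inE eqxx | exists X].
  have [|e e_es [X [/on_A XA Xe fX]]] := es_cover x; first by rewrite inE xC.
  by exists e; [rewrite inE e_es orbT | exists X].
Qed.

End Covering.

Lemma enc_nat_inj n n' s s' :
  enc_nat n ++ s = enc_nat n' ++ s' -> n = n' /\ s = s'.
Proof.
elim: n n' => [|n IHn] [|n'] //=; first by case.
by case=> /IHn [-> ->].
Qed.

(** The kernel yields a mere string; being a yes-instance must not depend on how that string is
    decoded. *)
Lemma enc_clique_inj G k G' k' : enc_clique G k = enc_clique G' k' ->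
  has_clique G k -> has_clique G' k'.
Proof.
case: G G' => N e sym irr [N' e' sym' irr'].
rewrite /enc_clique /enc_graph -!catA /= => /enc_nat_inj [eN]; subst N'.
move/eqP; rewrite eqseq_cat ?size_allpairs // => /andP [/eqP ee /eqP ek].
have {}ek : k = k' by have := @enc_nat_inj k k' [::] [::]; rewrite !cats0 => /(_ ek) [].
have {}ee x y : e x y = e' x y.
  by have /eq_in_allpairs -> := ee; rewrite ?mem_enum.
subst k'; case=> S [cS cardS]; exists S; split=> // x y xS yS neq.
by rewrite /= -ee; apply: cS.
Qed.

(** * From a polynomial kernel to short advice *)

Lemma computes_within_le M k k' x y :
  k <= k' -> computes_within M k x y -> computes_within M k' x y.
Proof.
move=> /subnK <- [hk out_k]; rewrite /computes_within iterD.
have halted m cfg : tm_halt cfg.1 -> iter m (@tm_step M) cfg = cfg.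
  by move=> hc; elim: m => //= m ->; move: hc; rewrite /tm_step; case: cfg => q ts /= ->.
by rewrite halted.
Qed.

Lemma computes_within_fun M k k' x y y' :
  computes_within M k x y -> computes_within M k' x y' -> y = y'.
Proof.
move=> h h'; case/orP: (leq_total k k') => le_k.
  by have [_ <-] := computes_within_le le_k h; case: h' => _ <-.
by have [_ <-] := computes_within_le le_k h'; case: h => _ <-.
Qed.

Lemma accepts_runs (I : finType) (P : mach (option I)) z n s :
  runs P (@init_tapes I z) n s -> accepts P z -> reads s None = Some true.
Proof.
move=> [k [q [_ e hq]]] [k' [q' [s' [_ e' hq' <-]]]]; congr (reads _ _).
have [le_k|le_k] : k <= k' \/ k' <= k by case: (leqP k k') => [|/ltnW]; [left|right].
- by move: e'; rewrite (iter_halted_le le_k) e // => -[].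
- by move: e; rewrite (iter_halted_le le_k) e' // => -[].
Qed.

Lemma runs_accepts (I : finType) (P : mach (option I)) z n s :
  runs P (@init_tapes I z) n s -> n < size z -> reads s None = Some true ->
  accepts P z.
Proof.
move=> [k [q [le_k e hq]]] lt_n h; exists k, q, s; split=> //.
exact: leq_ltn_trans lt_n.
Qed.

Lemma select_in e es w : (select e es w).1 \in e :: es.
Proof.
elim: es e w => [|e' es IHes] e w /=; first by rewrite inE.
by case: w => [|[] w]; rewrite inE ?eqxx // IHes orbT.
Qed.

Lemma select_nth e es r w : r <= size es ->
  select e es (nseq r true ++ false :: w) = (nth e (e :: es) r, w).
Proof.
elim: es e r => [|e' es IHes] e [|r] //= le_r; rewrite IHes //.
by congr pair; apply: set_nth_default.
Qed.

Lemma size_advice e es m : (forall e', e' \in e :: es -> size (entry_code e') <= m) ->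
  size (advice e es) <= (size es).+1 * m.+1.
Proof.
elim: es e => [|e' es IHes] e le_m /=.
  by rewrite mul1n ltnS le_m ?inE.
rewrite size_cat mulSn -addSn leq_add //; first by rewrite ltnS le_m ?inE ?eqxx.
by apply: IHes => e'' h; apply: le_m; rewrite inE h orbT.
Qed.

(** * Advice and certificates obtained from a kernel *)

Section Kernel.
Variables (lm : modification) (M : TM) (c d : nat).
Hypothesis kernel : forall I : reopt_instance, valid_instance lm I ->
  exists (H : graph) (h : nat),
    [/\ computes_within M (poly_bound c (size (enc_instance I)))
          (enc_instance I) (enc_clique H h),
        has_clique H h <-> has_clique (new_graph I) (new_k I),
        size (enc_clique H h) <= poly_bound d (new_k I) &
        h <= poly_bound d (new_k I)].

Variables (L VL : language) (cW cV : nat) (MV : TM).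
Hypothesis decV : forall x, exists b : bool,
  computes_within MV (poly_bound cV (size x)) x [:: b] /\ (VL x <-> b).
Hypothesis defL : forall x, L x <->
  exists w, size w <= poly_bound cW (size x) /\ VL (pair_enc x w).

Definition witness_size n := poly_bound cW n.
Definition run_time n := poly_bound cV (2 * n + witness_size n).+1.
Definition run_var n : finType := cell_var MV n (witness_size n) (run_time n).
Definition run_sat n :=
  @satisfiable MV n (witness_size n) (run_time n).

Lemma run_satP n x : size x = n ->
  L x <-> run_sat n (fun j b => nth false x j == b).
Proof.
move=> sz_x; split=> [/defL [w [sz_w Vw]]|sat].
  apply: (accept_satisfiable (w := w) sz_x); rewrite -?sz_x //.
  have [b [run_b Vb]] := decV (pair_enc x w).
  have {Vb} eb : b by apply/Vb.
  rewrite eb in run_b; apply: computes_within_le run_b.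
  by apply: leq_poly_bound; rewrite size_pair_enc ltnS leq_add2l.
have [w [sz_w run_w]] := satisfiable_accept sz_x sat.
apply/defL; exists w; split; first by rewrite sz_x.
have [b [run_b Vb]] := decV (pair_enc x w).
by apply/Vb; case: (computes_within_fun run_b run_w).
Qed.

Definition out_size n := poly_bound d #|run_var n|.+1.
(** There are fewer than [2 ^ m.+1] strings of length at most [m], as the counting of tuples
    requires. The definition is not circular: [out_size] depends on the parameter, that is on the
    number of variables, and not on the number of inputs. *)
Definition arity n := (out_size n).+1.

Definition run_template n : seq (bool + 'I_(arity n) * (nat * bool)) :=
  template (@cells_ok MV n (witness_size n) (run_time n))
    (@choice_code MV n (witness_size n) (run_time n)) (arity n) lm.

Definition run_instance n (rho : 'I_(arity n) -> nat -> bool -> bool) : reopt_instance :=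
  template_instance (@cells_ok MV n (witness_size n) (run_time n))
    (@choice_code MV n (witness_size n) (run_time n)) (t := arity n) rho lm.

Definition kernel_time n := poly_bound c (size (run_template n)).

Lemma kernel_instance n (rho : 'I_(arity n) -> nat -> bool -> bool) :
  exists (H : graph) (h : nat),
  [/\ computes_within M (kernel_time n) (enc_instance (run_instance rho))
        (enc_clique H h),
      has_clique H h <-> exists i, run_sat n (rho i) &
      size (enc_clique H h) <= out_size n].
Proof.
have valid : valid_instance lm (run_instance rho).
  exact: template_instance_valid.
have [H [h [run iff_h sz_h _]]] := kernel valid; exists H, h; split=> //.
  move: run; rewrite /kernel_time.
  by rewrite -[in poly_bound _ _]templateP size_map.
rewrite iff_h; apply: template_instance_clique.
rewrite !card_prod !card_ord; have : 0 < (head_pos n (witness_size n) (run_time n)).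
  by rewrite /head_pos addn2.
by move: (head_pos _ _ _) => m; nia.
Qed.

Definition kernel_out n (rho : 'I_(arity n) -> nat -> bool -> bool) : seq bool :=
  tm_output (iter (kernel_time n) (@tm_step M)
    (tm_init M (enc_instance (run_instance rho)))).

Definition entry_of n (p : 'I_(arity n)) (y : seq bool) : entry :=
  (map (address n p) (run_template n), y).

Lemma spelled_entry n (p : 'I_(arity n)) y x w :
  spelled x (entry_of p y) w =
  enc_instance (run_instance (table_rows n p x (undbl w))).
Proof.
rewrite -templateP /spelled -map_comp; apply: eq_map => a /=.
exact: nth_table_address.
Qed.

Definition never_yes y := forall H h, y = enc_clique H h -> ~ has_clique H h.

Definition no_entry n (e : entry) : Prop :=
  exists p y, e = @entry_of n p y /\ never_yes y.

(** The rows guessed for the other inputs need not come from any strings, which does no harm: the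
    template is a valid instance for every [rho], and row [p], written from [x] by the machine
    itself, already makes it a yes-instance. The output of the kernel is then a yes-instance too,
    unlike the stored string. *)
Lemma advice_sound n e es x w :
  (forall e', e' \in e :: es -> no_entry n e') -> size x = n -> L x ->
  ~ accepts (verifier M) (pair_enc (pair_enc x (advice e es)) w).
Proof.
move=> no_es sz_x Lx acc.
have [p [y [esel ny]]] := no_es _ (select_in e es w).
have [H [h [[halt_h out_h] iff_h _]]] :=
  kernel_instance (table_rows n p x (undbl (select e es w).2)).
have Hh : has_clique H h.
  apply/iff_h; exists p; move/(run_satP sz_x): Lx; apply: satisfiable_ext => j b lt_j.
  by rewrite table_rows_self.
have := @runs_verifier M x e es w (kernel_time n).
cbv zeta; rewrite esel spelled_entry => /(_ halt_h) [s [run_s]].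
rewrite (accepts_runs run_s acc) out_h => -[/esym/eqP ey].
exact: ny (esym ey) Hh.
Qed.

(* The padding of the witness pays for the clock of [accepts]. *)
Definition pad_size n (a : nat) :=
  200 * ((2 * n + a).+1 + 2 * (n * arity n)) + kernel_time n + 101.

Lemma advice_complete n e es r p (xs : 'I_(arity n) -> seq bool) :
  r <= size es -> (forall i, size (xs i) = n) ->
  nth e (e :: es) r = entry_of p (kernel_out (input_rows n xs)) ->
  accepts (verifier M) (pair_enc (pair_enc (xs p) (advice e es))
    (nseq r true ++ false ::
     pair_enc (row_bits n xs) (nseq (pad_size n (size (advice e es))) false))).
Proof.
move=> le_r sz_xs er; set pad := nseq (pad_size _ _) _.
have [H [h [[halt_h out_h] _ _]]] := kernel_instance (input_rows n xs).
have := @runs_verifier M (xs p) e es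
  (nseq r true ++ false :: pair_enc (row_bits n xs) pad) (kernel_time n).
cbv zeta; rewrite select_nth // er spelled_entry undbl_pair_enc table_rows_bits //.
move=> /(_ halt_h) [s [run_s es']].
apply: (@runs_accepts _ (verifier M) _ _ _ run_s); last by rewrite [LHS]es' eqxx.
rewrite [size (pair_enc (pair_enc _ _) _)]size_pair_enc size_cat /= !size_pair_enc.
rewrite /pad !size_nseq size_mkseq sz_xs /pad_size.
by move: (size (advice _ _)) (n * arity n) (kernel_time n) => m1 m2 m3; clear; lia.
Qed.

(** Each bit of the template costs at most the largest address plus 2, and each bit of the output at
    most 3. *)
Definition code_size n :=
  size (run_template n) * (2 + 2 * n + 2 * (n * arity n)) +
  2 * size (run_template n) + 3 * out_size n + 2.

Lemma size_entry_code n (p : 'I_(arity n)) y : size y <= out_size n ->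
  size (entry_code (@entry_of n p y)) <= code_size n.
Proof.
move=> le_y; rewrite /entry_code size_cat !size_unary_list !size_map /code_size /=.
have le_sum : sumn (map (address n p) (run_template n)) <=
    size (run_template n) * (2 + 2 * n + 2 * (n * arity n)).
  elim: (run_template n) => //= a s IHs.
  by rewrite mulSn leq_add // address_bound.
have le_sum' : sumn (map nat_of_bool y) <= size y.
  by elim: (y) => //= -[] s IHs; rewrite ?add1n ?add0n ?ltnS // ltnW.
lia.
Qed.

Definition advice_size n := n.+2 * (code_size n).+1.
(** At most [n.+1] for the selector, two delimiters, the rows doubled by [pair_enc], and the
    padding. *)
Definition cert_size n :=
  n.+3 + 4 * (n * arity n) + pad_size n (advice_size n).

Lemma advice_exists n : exists a : seq bool,
  [/\ size a <= advice_size n,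
      forall x, size x = n -> ~ L x -> exists w, size w <= cert_size n /\
        accepts (verifier M) (pair_enc (pair_enc x a) w) &
      forall x w, size x = n -> L x ->
        ~ accepts (verifier M) (pair_enc (pair_enc x a) w)].
Proof.
pose U : finType := n.-tuple bool.
pose A : {set U} := [set x : U | if excluded_middle_informative (L x) then false else true].
have inA (x : U) : x \in A <-> ~ L x.
  by rewrite inE; case: excluded_middle_informative.
pose rows (X : {ffun 'I_(arity n) -> U}) i : seq bool := X i.
pose f X := kernel_out (input_rows n (rows X)).
have f_size X : size (f X) <= out_size n.
  by have [H [h [[_ <-] _ ?]]] := kernel_instance (input_rows n (rows X)).
pose Y : finType := (out_size n).-bseq bool.
pose f' X : Y := insubd [bseq] (f X).
have f'E X : f' X = f X :> seq bool by rewrite val_insubd f_size.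
have card_Y : #|Y| <= 2 ^ arity n.
  rewrite card_bseq card_bool /arity; elim: (out_size n).+1 => [|m IHm].
    by rewrite big_ord0.
  by rewrite big_ord_recr /= expnS mul2n -addnn leq_add2r.
(* [n.+1] rounds rather than [n], because a single remaining element still takes a round. *)
have [|es [le_es es_out es_cover]] := @cover_all U Y (arity n) f' isT card_Y n.+1 A.
  apply: leq_ltn_trans (max_card _) _; rewrite card_tuple card_bool.
  by rewrite ltn_exp2l.
pose p0 : 'I_(arity n) := ord0.
pose ent (e : 'I_(arity n) * Y) := entry_of e.1 e.2.
(* The list of entries must not be empty; the empty string is never an output. *)
pose e0 := @entry_of n p0 [::].
have sz_adv : size (advice e0 (map ent es)) <= advice_size n.
  apply: leq_trans (size_advice (m := code_size n) _) _.
    move=> e'; rewrite inE => /orP [/eqP ->|/mapP [e _ ->]].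
      exact: size_entry_code.
    by apply: size_entry_code; apply: size_bseq.
  by rewrite size_map /advice_size leq_mul.
exists (advice e0 (map ent es)); split=> //.
- move=> x sz_x nLx; pose xt : U := Tuple (introT eqP sz_x).
  have /es_cover [e e_es [X [_ Xe fX]]] : xt \in A by apply/inA.
  have ex : x = rows X e.1 by rewrite /rows Xe.
  have lt_e : index e es < size es by rewrite index_mem.
  (* The successor skips the dummy entry [e0]. *)
  exists (nseq (index e es).+1 true ++ false :: pair_enc (row_bits n (rows X))
    (nseq (pad_size n (size (advice e0 (map ent es)))) false)); split.
    have le_q : pad_size n (size (advice e0 (map ent es))) <= pad_size n (advice_size n).
      by rewrite /pad_size; move: sz_adv; clear; lia.
    move: (pad_size n (size _)) le_q => q le_q.
    rewrite size_cat /= size_pair_enc !size_nseq size_mkseq /cert_size.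
    move: lt_e le_es le_q; move: (pad_size _ _) (n * arity n) => m1 m2.
    by clear; lia.
  rewrite {1}ex; apply: advice_complete.
  - by rewrite size_map.
  - by move=> i; rewrite size_tuple.
  - by rewrite /= (nth_map e) // nth_index // /ent -fX f'E.
- move=> x w; apply: advice_sound => e'; rewrite inE => /orP [/eqP ->|].
    exists p0, [::]; split=> // H h; rewrite /enc_clique /enc_graph /enc_nat.
    by case: (nseq (order H) true).
  (* If the stored output encoded a yes-instance, some entry of the tuple [X] would be in [L],
     although [X] is a tuple over [A]. *)
  case/mapP => e /es_out [X XA fX] ->; exists e.1, e.2; split=> //.
  move=> H h eH; rewrite -fX f'E in eH => cH.
  have [H' [h' [[_ out'] iff' _]]] := kernel_instance (input_rows n (rows X)).
  have : has_clique H' h' by apply: enc_clique_inj cH; rewrite -eH -out'.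
  case/iff' => i sat_i; have /inA := (ffun_onP XA) i; apply.
  apply/(run_satP (size_tuple _)); apply: satisfiable_ext sat_i => j b lt_j.
  by rewrite /input_rows lt_j.
Qed.

Lemma poly_out_size : poly_bounded out_size.
Proof.
apply: poly_bounded_comp; apply: poly_bounded_le (_ : poly_bounded (fun n =>
  ((run_time n).+1 * (tm_work MV).+1 *
   (run_time n + (n.*2 + witness_size n) + 2).*2.+1).+1)).
  by move=> n; rewrite !card_prod !card_ord.
by rewrite /run_time /witness_size; poly_bounded.
Qed.

Lemma poly_size_template : poly_bounded (fun n => size (run_template n)).
Proof.
have card_var : poly_bounded (fun n => #|run_var n|).
  apply: poly_bounded_le (_ : poly_bounded (fun n => (run_time n).+1 *
    (tm_work MV).+1 * (run_time n + (n.*2 + witness_size n) + 2).*2.+1)).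
    by move=> n; rewrite !card_prod !card_ord.
  by rewrite /run_time /witness_size; poly_bounded.
pose N n := #|run_var n| * #|cell_val MV| + arity n + 2.
have poly_N : poly_bounded N.
  by have := poly_out_size; rewrite /N /arity => ?; poly_bounded.
apply: poly_bounded_le (_ : poly_bounded (fun n =>
  2 * (N n * N n) + 6 * N n + #|run_var n| + 10)).
  move=> n; have := size_template (@cells_ok MV n (witness_size n) (run_time n))
    (@choice_code MV n (witness_size n) (run_time n)) (arity n) lm.
  by rewrite !card_option card_sum card_prod card_ord -addn2.
by poly_bounded.
Qed.

Lemma poly_advice_size : poly_bounded advice_size.
Proof.
have := poly_size_template; have := poly_out_size.
by rewrite /advice_size /code_size /arity => ? ?; poly_bounded.
Qed.

Lemma poly_cert_size : poly_bounded cert_size.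
Proof.
have := poly_advice_size; have := poly_size_template; have := poly_out_size.
by rewrite /cert_size /pad_size /kernel_time /arity => ? ? ?; poly_bounded.
Qed.

Lemma kernel_advice : with_poly_advice incoNP L.
Proof.
have [ca caP] := poly_advice_size; have [cc ccP] := poly_cert_size.
pose a n := proj1_sig (constructive_indefinite_description _ (advice_exists n)).
have aP n := proj2_sig (constructive_indefinite_description _ (advice_exists n)).
(* [incoNP] asks that the complement be in NP: up to a double negation, it consists of the strings
   that have an accepted certificate. *)
exists (fun z => ~ exists w, size w <= poly_bound cc (size z) /\
  accepts (verifier M) (pair_enc z w)), a, ca; split.
- exists (accepts (verifier M)), cc; split; first exact: inP_accepts.
  by move=> z; split=> [/NNPP //|h]; apply.
- by move=> n; have [le_a _ _] := aP n; apply: leq_trans le_a (caP n).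
- move=> x; have [_ complete sound] := aP (size x).
  split=> [Lx [w [_]]|no_w]; first exact: sound.
  apply: NNPP => /(complete x erefl) [w [le_w acc]]; apply: no_w; exists w.
  split=> //; apply: leq_trans le_w (leq_trans (ccP _) (leq_poly_bound _ _)).
  by rewrite size_pair_enc; lia.
Qed.

End Kernel.

Lemma lm_clique_in_PK_coNP_poly lm : lm_clique_in_PK lm -> NP_sub_coNP_poly.
Proof.
move=> [M [c [d kernel]]] L [VL [cW [[MV [cV decV]] defL]]].
exact: (kernel_advice kernel decV defL).
Qed.

Theorem theorem12 :
  ~ NP_sub_coNP_poly ->
  ~ lm_clique_in_PK EdgeAddition /\ ~ lm_clique_in_PK VertexAddition.
Proof. by move=> no; split=> /lm_clique_in_PK_coNP_poly. Qed.
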